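(* Let $M^n=M_0\times M_1$ be a product manifold endowed with a polar metric. Let $f\colon M^n\to\mathbb{R}^N$ be an isometric immersion whose second fundamental form is adapted to the product net of $M^n$. Then there exist an immersion $f_1\colon M_1\to\mathbb{R}^N$, a parallel vector bundle isometry $\phi\colon M_1\times\mathbb{R}^s\to E$ onto a flat parallel subbundle $E$ of the normal bundle $N_{f_1}M_1$, and an immersion $f_0\colon M_0\to\Omega(f_1;\phi)\subset\mathbb{R}^s$ such that $f$ is the partial tube determined by $(f_0,f_1,\phi)$, that is, $f(p_0,p_1)=f_1(p_1)+\phi_{p_1}(f_0(p_0))$ for all $(p_0,p_1)\in M_0\times M_1$.
   Context: Product manifolds are connected. With $\pi_i\colon M_0\times M_1\to M_i$ the projections, a Riemannian metric $g$ on $M_0\times M_1$ is polar if there are a Riemannian metric $g_0$ on $M_0$ and a smooth family $g_1=(g_1(p_0))_{p_0\in M_0}$ of Riemannian metrics on $M_1$ parametrized by $M_0$ with $g=\pi_0^*g_0+\pi_1^*(g_1\circ\pi_0)$, i.e. $g(p)(X,Y)=g_0(\pi_{0*}X,\pi_{0*}Y)+g_1(\pi_0(p))(\pi_{1*}X,\pi_{1*}Y)$. The product net of $M_0\times M_1$ is $(E_0,E_1)$, where $E_i$ is the subbundle of tangent spaces to the factor $M_i$. The second fundamental form $\alpha$ of $f$ is adapted to it if $\alpha(E_0,E_1)=0$. For an immersion $f_1\colon M_1\to\mathbb{R}^N$, $M_1$ carries the induced metric, $N_{f_1}M_1$ is the normal bundle with the normal connection, and $A^{f_1}_\xi$ is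 the shape operator, $\langle A^{f_1}_\xi X,Y\rangle=\langle\alpha_{f_1}(X,Y),\xi\rangle$. A parallel vector bundle isometry $\phi\colon M_1\times\mathbb{R}^s\to E$ onto a flat parallel subbundle $E\subset N_{f_1}M_1$ is a smooth bundle map such that each $\phi_{p_1}=\phi(p_1,\cdot)\colon\mathbb{R}^s\to E(p_1)$ is a linear isometry and, for each fixed $y\in\mathbb{R}^s$, $p_1\mapsto\phi_{p_1}(y)$ is parallel in the normal connection. Put $$\Omega(f_1;\phi)=\{Y\in\mathbb{R}^s:\ I-A^{f_1}_{\phi_{p_1}(Y)}\ \text{is a nonsingular endomorphism of } T_{p_1}M_1\text{ for every }p_1\in M_1\}.$$ The partial tube determined by $(f_0,f_1,\phi)$, for an immersion $f_0\colon M_0\to\Omega(f_1;\phi)$, is the immersion $f(p_0,p_1)=f_1(p_1)+\phi_{p_1}(f_0(p_0))$. *)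

(* Defs.v *)
From HB Require Import structures.
From mathcomp Require Import all_boot all_order all_algebra.
From mathcomp Require Import all_classical all_reals all_analysis.
Set Implicit Arguments.
Unset Strict Implicit.
Unset Printing Implicit Defensive.
Import Order.TTheory GRing.Theory Num.Theory.
Import numFieldNormedType.Exports.
Local Open Scope classical_set_scope.
Local Open Scope ring_scope.

(* Meant for open [A]. The norm of ['rV_n] in the library is the sup norm; this
   affects neither the topology nor derivatives. *)
Fixpoint Ck_on (R : realType) (V W : normedModType R) (k : nat) (A : set V)
    (f : V -> W) : Prop :=
  match k with
  | 0 => forall x, A x -> {for x, continuous f}
  | k'.+1 => (forall x, A x -> differentiable f x) /\
             (forall v, Ck_on k' A ('D_v f))
  end.

Definition Coo_on (R : realType) (V W : normedModType R) (A : set V)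
    (f : V -> W) : Prop := forall k, Ck_on k A f.

Lemma differentiable_near0 (R : realType) (V W : normedModType R)
    (h : V -> W) x : (\forall y \near x, h y = 0) -> differentiable h x.
Proof.
move=> hx; have hx0 : h x = 0 := nbhs_singleton hx.
have c0 : continuous (\0 : {linear V -> W}) by move=> y; exact: cvg_cst.
have e0 : h \o shift x = cst (h x) + (\0 : {linear V -> W}) +o_ 0 id.
  apply/eqaddoP => _/posnumP[e]; near=> y.
  rewrite /= !fctE /= hx0 addr0 subr0.
  suff -> : h (y + x) = 0 by rewrite normr0 mulr_ge0.
  near: y; have : (fun y : V => y + x) @ 0 --> x.
    rewrite -[X in _ --> X]add0r; apply: cvgD; [exact: cvg_id|exact: cvg_cst].
  by move/(_ _ hx).
apply/diff_locallyP; rewrite (diff_unique c0 e0); split => //.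
Unshelve. all: by end_near. Qed.

Lemma Ck_on_eq (R : realType) (V W : normedModType R) k (A : set V)
    (f g : V -> W) :
  open A -> (forall x, A x -> f x = g x) -> Ck_on k A f -> Ck_on k A g.
Proof.
move=> oA; elim: k f g => [|k IH] f g fg /=.
  move=> cf x Ax; have /cf := Ax; rewrite /prop_for /continuous_at -(fg _ Ax).
  apply: cvg_trans; apply: near_eq_cvg.
  by near=> y; apply: fg; near: y; exact: open_nbhs_nbhs.
have near_fg x : A x -> \forall y \near x, f y = g y.
  by move=> Ax; near=> y; apply: fg; near: y; exact: open_nbhs_nbhs.
move=> [df Dk]; split=> [x Ax|v].
  have -> : g = f + (g - f) by rewrite addrC subrK.
  apply: differentiableD; first exact: df.
  apply: differentiable_near0; near=> y; rewrite !fctE; apply/eqP.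
  by rewrite subr_eq0 eq_sym; apply/eqP; near: y; exact: near_fg.
by apply: (IH _ _ _ (Dk v)) => x Ax; apply: near_eq_derive; exact: near_fg.
Unshelve. all: by end_near. Qed.

Lemma openX (T0 T1 : topologicalType) (A0 : set T0) (A1 : set T1) :
  open A0 -> open A1 -> open (A0 `*` A1).
Proof.
rewrite openE => o0; rewrite openE => o1; rewrite openE => x [/o0 n0 /o1 n1].
by exists (A0, A1).
Qed.

Lemma Ck_on_prod (R : realType) (V0 V1 W0 W1 : normedModType R) k
    (A0 : set V0) (A1 : set V1) (f0 : V0 -> W0) (f1 : V1 -> W1) :
  open A0 -> open A1 -> Ck_on k A0 f0 -> Ck_on k A1 f1 ->
  Ck_on k (A0 `*` A1) (fun x : V0 * V1 => (f0 x.1, f1 x.2)).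
Proof.
move=> o0 o1; have oA : open (A0 `*` A1) by exact: openX.
elim: k f0 f1 => [|k IH] f0 f1 /=.
  move=> c0 c1 x [Ax0 Ax1]; apply: cvg_pair.
    by apply: (@cvg_comp _ _ _ fst f0); [exact: cvg_fst|exact: c0].
  by apply: (@cvg_comp _ _ _ snd f1); [exact: cvg_snd|exact: c1].
move=> [d0 D0] [d1 D1].
have dfst x : differentiable (@fst V0 V1) x.
  by apply: linear_differentiable => y; exact: cvg_fst.
have dsnd x : differentiable (@snd V0 V1) x.
  by apply: linear_differentiable => y; exact: cvg_snd.
have dF0 x : (A0 `*` A1) x -> differentiable (f0 \o fst) x.
  by case=> Ax _; apply: differentiable_comp => //; exact: d0.
have dF1 x : (A0 `*` A1) x -> differentiable (f1 \o snd) x.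
  by case=> _ Ax; apply: differentiable_comp => //; exact: d1.
split=> [x Ax|v].
  by apply: differentiable_pair; [exact: dF0|exact: dF1].
apply: (Ck_on_eq oA _ (IH _ _ (D0 v.1) (D1 v.2))) => x Ax.
have [Ax0 Ax1] := Ax.
rewrite (deriveE _ (differentiable_pair (dF0 _ Ax) (dF1 _ Ax))).
rewrite (diff_pair (dF0 _ Ax) (dF1 _ Ax)) /=.
have cf : continuous (@fst V0 V1) by move=> y; exact: cvg_fst.
have cs : continuous (@snd V0 V1) by move=> y; exact: cvg_snd.
rewrite (deriveE _ (d0 _ Ax0)) (deriveE _ (d1 _ Ax1)).
congr pair.
  rewrite (diff_comp (dfst x) (d0 _ Ax0)) /=.
  by rewrite (diff_lin x cf).
rewrite (diff_comp (dsnd x) (d1 _ Ax1)) /=.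
by rewrite (diff_lin x cs).
Qed.

(* A smooth manifold without boundary, Hausdorff and second countable, given by
   an atlas of charts with values in a normed space [V], which is R^m for the
   two factors below and R^m * R^n, with component charts, for their product.
   [param c] is the inverse of [coord c]; both are total functions whose values
   outside [dom c] and [coord c @` dom c] are irrelevant. *)
Record manifold (R : realType) (V : normedModType R) := Manifold {
  carrier :> topologicalType;
  chart : Type;
  dom : chart -> set carrier;
  coord : chart -> carrier -> V;
  param : chart -> V -> carrier;
  dom_open : forall c, open (dom c);
  codom_open : forall c, open (coord c @` dom c);
  coordK : forall c p, dom c p -> param c (coord c p) = p;
  coord_cont : forall c p, dom c p -> {for p, continuous (coord c)};
  param_cont : forall c x, (coord c @` dom c) x ->
    {for x, continuous (param c)};
  dom_cover : forall p, exists c, dom c p;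
  transition_smooth : forall c c',
    Coo_on (coord c @` (dom c `&` dom c')) (coord c' \o param c);
  carrier_hausdorff : hausdorff_space carrier;
  carrier_second_countable : @second_countable carrier
}.

Section product.
Context (R : realType) (V0 V1 : normedModType R).
Context (M0 : manifold V0) (M1 : manifold V1).

Lemma overlap_open (V : normedModType R) (M : manifold V) (c : chart M)
  (O : set M) : open O -> open (coord c @` (dom c `&` O)).
Proof.
move=> oO; rewrite openE => _ [p [cp Op] <-].
have ncod : nbhs (coord c p) (coord c @` dom c).
  by apply: open_nbhs_nbhs; split; [exact: codom_open|exists p].
have npar : nbhs (coord c p) (param c @^-1` O).
  have cont := @param_cont _ _ M c (coord c p) (ex_intro2 _ _ p cp erefl).
  apply: cont; rewrite coordK //; exact: open_nbhs_nbhs.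
apply: filterS (filterI ncod npar) => _ [[q cq <-] Oq].
by exists q => //; split=> //; rewrite -(coordK cq).
Qed.

Let pdom (c : chart M0 * chart M1) : set (M0 * M1) := dom c.1 `*` dom c.2.
Let pcoord (c : chart M0 * chart M1) (p : M0 * M1) : V0 * V1 :=
  (coord c.1 p.1, coord c.2 p.2).
Let pparam (c : chart M0 * chart M1) (x : V0 * V1) : M0 * M1 :=
  (param c.1 x.1, param c.2 x.2).

Lemma pcoord_image c (A0 : set M0) (A1 : set M1) :
  pcoord c @` (A0 `*` A1) = (coord c.1 @` A0) `*` (coord c.2 @` A1).
Proof.
apply/seteqP; split=> [_ [p [? ?] <-]|].
  by split; [exists p.1|exists p.2].
by move=> [a b] [/= [p ? <-] [q ? <-]]; exists (p, q).
Qed.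

Lemma pdom_open c : open (pdom c).
Proof. by apply: openX; exact: dom_open. Qed.

Lemma pcodom_open c : open (pcoord c @` pdom c).
Proof. by rewrite pcoord_image; apply: openX; exact: codom_open. Qed.

Lemma pcoordK c p : pdom c p -> pparam c (pcoord c p) = p.
Proof. by case: p => p q [? ?]; congr pair; exact: coordK. Qed.

Lemma pcoord_cont c p : pdom c p -> {for p, continuous (pcoord c)}.
Proof.
move=> [h0 h1]; apply: cvg_pair.
  by apply: (@cvg_comp _ _ _ fst (coord c.1)); [exact: cvg_fst|exact: coord_cont].
by apply: (@cvg_comp _ _ _ snd (coord c.2)); [exact: cvg_snd|exact: coord_cont].
Qed.

Lemma pparam_cont c x : (pcoord c @` pdom c) x ->
  {for x, continuous (pparam c)}.
Proof.
rewrite pcoord_image => -[h0 h1]; apply: cvg_pair.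
  by apply: (@cvg_comp _ _ _ fst (param c.1)); [exact: cvg_fst|exact: param_cont].
by apply: (@cvg_comp _ _ _ snd (param c.2)); [exact: cvg_snd|exact: param_cont].
Qed.

Lemma pdom_cover p : exists c, pdom c p.
Proof.
by have [[c0 ?] [c1 ?]] := (dom_cover p.1, dom_cover p.2); exists (c0, c1).
Qed.

Lemma ptransition_smooth c c' :
  Coo_on (pcoord c @` (pdom c `&` pdom c')) (pcoord c' \o pparam c).
Proof.
have -> : pdom c `&` pdom c' =
    (dom c.1 `&` dom c'.1) `*` (dom c.2 `&` dom c'.2).
  by apply/seteqP; split=> p /=; rewrite /pdom /=; tauto.
move=> k; rewrite pcoord_image.
apply: (Ck_on_prod _ _ (transition_smooth _ _ _) (transition_smooth _ _ _));
  by apply: overlap_open; exact: dom_open.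
Qed.

Lemma prod_hausdorff : hausdorff_space (M0 * M1)%type.
Proof.
move=> p q clpq; apply: injective_projections.
  apply: (@carrier_hausdorff _ _ M0) => A B nA nB.
  have [||r [? ?]] := clpq (fst @^-1` A) (fst @^-1` B);
    [exact: cvg_fst|exact: cvg_fst|by exists r.1].
apply: (@carrier_hausdorff _ _ M1) => A B nA nB.
have [||r [? ?]] := clpq (snd @^-1` A) (snd @^-1` B);
  [exact: cvg_snd|exact: cvg_snd|by exists r.2].
Qed.

Lemma prod_second_countable : @second_countable (M0 * M1)%type.
Proof.
have [B0 cB0 [oB0 bB0]] := carrier_second_countable M0.
have [B1 cB1 [oB1 bB1]] := carrier_second_countable M1.
exists ((fun b => b.1 `*` b.2) @` (B0 `*` B1)).
  exact/(sub_countable (card_image_le _ _))/countableX.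
split=> [_ [[b0 b1] [/= h0 h1] <-]|x A [[A0 A1] /= [n0 n1] sA]].
  by apply: openX; [exact: oB0|exact: oB1].
have [b0 [Bb0 b0x] b0A] := bB0 _ _ n0; have [b1 [Bb1 b1x] b1A] := bB1 _ _ n1.
exists (b0 `*` b1); first by split=> //; exists (b0, b1).
by move=> y [? ?]; apply: sA; split; [exact: b0A|exact: b1A].
Qed.

Definition prod_manifold : manifold (V0 * V1)%type :=
  Manifold pdom_open pcodom_open pcoordK pcoord_cont pparam_cont pdom_cover
    ptransition_smooth prod_hausdorff prod_second_countable.

End product.

Definition dotv (R : realType) (N : nat) (x y : 'rV[R]_N) : R :=
  \sum_(i < N) x 0 i * y 0 i.

Section calculus.
Context (R : realType) (V : normedModType R) (M : manifold V).

Definition smooth_on (W : normedModType R) (O : set M) (f : M -> W) : Prop :=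
  forall c : chart M, Coo_on (coord c @` (dom c `&` O)) (f \o param c).

Definition smooth (W : normedModType R) (f : M -> W) : Prop :=
  smooth_on setT f.

(* A tangent vector at [p] is handled through its component vector [u : V] in a
   chart [c] around [p]. [dchart c u f] is the derivative of [f] along the
   vector field of [dom c] with constant components [u]; in particular
   [dchart c u f p] is the image under the differential of [f] at [p] of the
   tangent vector with components [u], and [dchart c u (coord c') p] are the
   components of that tangent vector in the chart [c']. *)
Definition dchart (W : normedModType R) (c : chart M) (u : V) (f : M -> W) :
    M -> W :=
  fun p => 'D_u (f \o param c) (coord c p).

(* [g c p u v] is the value at [p] on the tangent vectors with components [u]
   and [v] in the chart [c]; it is only meaningful for [dom c p]. *)
Definition metric := chart M -> M -> V -> V -> R.

Record riemannian (g : metric) : Prop := Riemannian {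
  metric_linear : forall c p, dom c p -> forall a u u' v,
    g c p (a *: u + u') v = a * g c p u v + g c p u' v;
  metric_sym : forall c p, dom c p -> forall u v, g c p u v = g c p v u;
  metric_pos : forall c p, dom c p -> forall u, u != 0 -> 0 < g c p u u;
  metric_change : forall c c' p, dom c p -> dom c' p -> forall u v,
    g c p u v = g c' p (dchart c u (coord c') p) (dchart c v (coord c') p);
  metric_smooth : forall c u v,
    smooth_on (dom c) (fun p => g c p u v : R^o)
}.

End calculus.

Section submanifold.
Context (R : realType) (V : normedModType R) (M : manifold V) (N : nat).
Implicit Types f xi : M -> 'rV[R]_N.

Definition immersion f : Prop :=
  smooth f /\
  forall c p, dom c p -> injective (fun u => dchart c u f p).

Definition isometric (g : metric M) f : Prop :=
  forall c p, dom c p -> forall u v,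
    dotv (dchart c u f p) (dchart c v f p) = g c p u v.

Definition tangent_space f (p : M) : set 'rV[R]_N :=
  [set w | exists c u, dom c p /\ w = dchart c u f p].

Definition normal_space f (p : M) : set 'rV[R]_N :=
  [set w | forall t, tangent_space f p t -> dotv t w = 0].

(* orthogonal projection onto the normal space *)
Definition normal_part f (p : M) (z : 'rV[R]_N) : 'rV[R]_N :=
  xget 0 [set w | normal_space f p w /\ tangent_space f p (z - w)].

(* The normal part of the derivative in R^N: the normal connection when [xi] is
   a normal field. *)
Definition nabla_perp f (c : chart M) (u : V) xi : M -> 'rV[R]_N :=
  fun p => normal_part f p (dchart c u xi p).

(* Gauss formula, the second tangent vector being extended with constant
   components in the chart [c]. *)
Definition second_ff f (c : chart M) (p : M) (u v : V) : 'rV[R]_N :=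
  nabla_perp f c u (dchart c v f) p.

Definition shape_op f (c : chart M) (p : M) (xi : 'rV[R]_N) (u : V) : V :=
  xget 0 [set w | forall v, dotv (dchart c w f p) (dchart c v f p) =
                            dotv (second_ff f c p u v) xi].

Definition subbundle (E : M -> {vspace 'rV[R]_N}) : Prop :=
  forall p, exists (O : set M) (r : nat) (e : 'I_r -> M -> 'rV[R]_N),
    [/\ open O, O p, forall i, smooth_on O (e i) &
        forall q, O q -> basis_of (E q) [tuple e i q | i < r]].

Definition section_on (E : M -> {vspace 'rV[R]_N}) (O : set M) xi : Prop :=
  [/\ open O, smooth_on O xi & forall q, O q -> xi q \in E q].

(* In the last clause the curvature is evaluated on vector fields with constant
   components in a chart, whose Lie bracket vanishes. *)
Record flat_parallel_subbundle f (E : M -> {vspace 'rV[R]_N}) : Prop :=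
  FlatParallelSubbundle {
  fps_subbundle : subbundle E;
  fps_normal : forall p w, w \in E p -> normal_space f p w;
  fps_parallel : forall O xi, section_on E O xi ->
    forall c p, O p -> dom c p -> forall u, nabla_perp f c u xi p \in E p;
  fps_flat : forall O xi, section_on E O xi ->
    forall c p, O p -> dom c p -> forall u v,
      nabla_perp f c u (nabla_perp f c v xi) p =
      nabla_perp f c v (nabla_perp f c u xi) p
}.

(* The domain M * R^s of the bundle map is read in the charts
   [fun q => (coord c q.1, q.2)]. *)
Record parallel_bundle_isometry f (E : M -> {vspace 'rV[R]_N}) (s : nat)
    (phi : M -> 'rV[R]_s -> 'rV[R]_N) : Prop := ParallelBundleIsometry {
  pbi_linear : forall p, linear (phi p);
  pbi_isometry : forall p y y', dotv (phi p y) (phi p y') = dotv y y';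
  pbi_onto : forall p w, w \in E p <-> exists y, phi p y = w;
  pbi_smooth : forall c : chart M,
    Coo_on ((coord c @` dom c) `*` [set: 'rV[R]_s])
      (fun xy : V * 'rV[R]_s => phi (param c xy.1) xy.2);
  pbi_parallel : forall y c p, dom c p -> forall u,
    nabla_perp f c u (phi^~ y) p = 0
}.

Definition Omega f (s : nat) (phi : M -> 'rV[R]_s -> 'rV[R]_N) :
    set 'rV[R]_s :=
  [set y | forall c p, dom c p ->
     bijective (fun u : V => u - shape_op f c p (phi p y) u)].

End submanifold.

Section polar.
Context (R : realType) (V0 V1 : normedModType R).
Context (M0 : manifold V0) (M1 : manifold V1).

Definition smooth_metric_family (g1 : M0 -> metric M1) : Prop :=
  (forall p0, riemannian (g1 p0)) /\
  forall (c : chart M1) u v,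
    @smooth_on _ _ (prod_manifold M0 M1) R^o (setT `*` dom c)
      (fun p => g1 p.1 c p.2 u v).

(* In the product charts the differentials of the two projections of
   [M0 * M1] are the two projections of [V0 * V1]. *)
Definition polar (g : metric (prod_manifold M0 M1)) : Prop :=
  exists (g0 : metric M0) (g1 : M0 -> metric M1),
    [/\ riemannian g0, smooth_metric_family g1 &
        forall (c : chart (prod_manifold M0 M1)) p, dom c p -> forall X Y,
          g c p X Y = g0 c.1 p.1 X.1 Y.1 + g1 p.1 c.2 p.2 X.2 Y.2].

Definition net0 : set (V0 * V1) := [set X | X.2 = 0].
Definition net1 : set (V0 * V1) := [set X | X.1 = 0].

Definition adapted (N : nat) (f : prod_manifold M0 M1 -> 'rV[R]_N) : Prop :=
  forall (c : chart (prod_manifold M0 M1)) p, dom c p ->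
  forall X Y, net0 X -> net1 Y -> second_ff f c p X Y = 0.

Definition partial_tube (N s : nat) (f0 : M0 -> 'rV[R]_s)
    (f1 : M1 -> 'rV[R]_N) (phi : M1 -> 'rV[R]_s -> 'rV[R]_N) :
    prod_manifold M0 M1 -> 'rV[R]_N :=
  fun p => f1 p.2 + phi p.2 (f0 p.1).

End polar.

(* Main.v *)
(* Write [D_u], [D_v] for derivatives along [M0] and [M1]. The normal part of
   [D_u D_v f] vanishes because [f] is adapted, and polarity kills its inner
   products with [D_u' f], which are both symmetric and antisymmetric in
   [u, u']; so [D_u D_v f] is tangent to the leaf [f (p0, .)]. Hence the
   orthogonal projection onto the tangent space of that leaf at [p1] does not
   depend on [p0], and [f (p0, .) - f (q0, .)] is a normal field along
   [f1 = f (q0, .)] whose derivative is tangent, i.e. a parallel normal field.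
   Inner products of parallel normal fields are constant, so a maximal
   orthonormal family of them spans all of them with constant coefficients; it
   gives [phi], and the coefficients of [f (p0, .) - f1] give [f0]. Finally
   [I - A_{phi (f0 p0)}] turns the differential of [f1] into that of
   [f (p0, .)], hence is nonsingular. *)
Require Import Defs.
From HB Require Import structures.
From mathcomp Require Import all_boot all_order all_algebra.
From mathcomp Require Import all_classical all_reals all_analysis.
From mathcomp Require Import lra.
Set Implicit Arguments.
Unset Strict Implicit.
Unset Printing Implicit Defensive.
Import Order.TTheory GRing.Theory Num.Theory.
Import numFieldNormedType.Exports.
Local Open Scope classical_set_scope.
Local Open Scope ring_scope.
(* vector.v exports another [coord]. *)
Import Defs.

(** * Smooth functions on open sets *)

Section smooth_functions.
Context (R : realType).

Lemma derive_linear (V W W' : normedModType R) (L : {linear W -> W'})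
    (f : V -> W) x v :
  continuous L -> differentiable f x -> 'D_v (L \o f) x = L ('D_v f x).
Proof.
move=> cL df; have dL := linear_differentiable (f x) cL.
rewrite deriveE; last exact: differentiable_comp.
by rewrite diff_comp //= diff_lin // deriveE.
Qed.

Lemma Ck_onW (V W : normedModType R) k (A : set V) (f : V -> W) :
  Ck_on k.+1 A f -> Ck_on k A f.
Proof.
elim: k f => [|k IH] f [df Df] /=.
  by move=> x Ax; apply: differentiable_continuous; exact: df.
by split=> // v; apply: IH.
Qed.

Lemma Ck_on_sub (V W : normedModType R) k (A B : set V) (f : V -> W) :
  B `<=` A -> Ck_on k A f -> Ck_on k B f.
Proof.
move=> BA; elim: k f => [|k IH] f /=; first by move=> cf x /BA; exact: cf.
by case=> df Df; split=> [x /BA|v]; [exact: df|exact: IH].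
Qed.

Lemma Ck_on_linear (V W W' : normedModType R) (L : {linear W -> W'}) k
    (A : set V) (f : V -> W) :
  continuous L -> open A -> Ck_on k A f -> Ck_on k A (L \o f).
Proof.
move=> cL oA; elim: k f => [|k IH] f /=.
  by move=> cf x Ax; apply: continuous_comp; [exact: cf|exact: cL].
case=> df Df; split=> [x Ax|v].
  apply: differentiable_comp; [exact: df|exact: linear_differentiable].
apply: (Ck_on_eq oA _ (IH _ (Df v))) => x Ax /=.
by rewrite derive_linear //; exact: df.
Qed.

Lemma Ck_on_cst (V W : normedModType R) k (A : set V) (a : W) :
  Ck_on k A (cst a).
Proof.
elim: k a => [|k IH] a /=; first by move=> x _; exact: cvg_cst.
split=> [x _|v]; first exact: differentiable_cst.
have -> : 'D_v (cst a) = cst (0 : W) by apply/funext => x; rewrite derive_cst.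
exact: IH.
Qed.

Lemma Ck_on_id (V : normedModType R) k (A : set V) : Ck_on k A (@id V).
Proof.
case: k => [|k] /=; first by move=> x _; exact: cvg_id.
split=> [x _|v]; first by apply: ex_diff.
have -> : 'D_v (@id V) = cst v by apply/funext => x; rewrite derive_id.
exact: Ck_on_cst.
Qed.

Lemma Ck_onD (V W : normedModType R) k (A : set V) (f g : V -> W) :
  open A -> Ck_on k A f -> Ck_on k A g -> Ck_on k A (f + g).
Proof.
move=> oA; elim: k f g => [|k IH] f g /=.
  by move=> cf cg x Ax; apply: cvgD; [exact: cf|exact: cg].
case=> df Df [dg Dg]; split=> [x Ax|v].
  by apply: differentiableD; [exact: df|exact: dg].
apply: (Ck_on_eq oA _ (IH _ _ (Df v) (Dg v))) => x Ax.
by rewrite deriveD //; apply: diff_derivable; [exact: df|exact: dg].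
Qed.

Lemma Ck_on_sum (V W : normedModType R) k (A : set V) n (f : 'I_n -> V -> W) :
  open A -> (forall i, Ck_on k A (f i)) ->
  Ck_on k A (fun x => \sum_(i < n) f i x).
Proof.
move=> oA cf; rewrite (_ : (fun x => _) = \sum_(i < n) f i); last first.
  by apply/funext => x; rewrite fct_sumE.
elim/big_ind : _ => //; [exact: Ck_on_cst|by move=> g h; exact: Ck_onD].
Qed.

Lemma Ck_onM (V : normedModType R) k (A : set V) (f g : V -> R^o) :
  open A -> Ck_on k A f -> Ck_on k A g ->
  Ck_on k A (fun x => f x * g x : R^o).
Proof.
move=> oA; elim: k f g => [|k IH] f g /=.
  by move=> cf cg x Ax; apply: cvgM; [exact: cf|exact: cg].
move=> cf cg; have [df Df] := cf; have [dg Dg] := cg; split=> [x Ax|v].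
  by apply: differentiableM; [exact: df|exact: dg].
have c1 := IH _ _ (Df v) (Ck_onW cg).
have c2 := IH _ _ (Ck_onW cf) (Dg v).
apply: (Ck_on_eq oA _ (Ck_onD oA c1 c2)) => x Ax.
have dfx := diff_derivable (v:=v) (df _ Ax);
  have dgx := diff_derivable (v:=v) (dg _ Ax).
apply: (eq_trans _ (esym (deriveM dfx dgx))).
by rewrite !fctE addrC; congr (_ + _); rewrite mulrC.
Qed.

(** A matrix coefficient as a linear map into [R^o], so that [Ck_on_linear] covers passing to
    coefficients. *)
Definition entry m n i j : 'M[R]_(m, n) -> R^o := fun A => A i j.
Lemma entry_is_linear m n i j : linear (@entry m n i j).
Proof. by move=> a A B; rewrite /entry !mxE. Qed.
HB.instance Definition _ m n i j :=
  GRing.isLinear.Build R 'M[R]_(m, n) R^o _ (@entry m n i j)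
    (@entry_is_linear m n i j).

Lemma entry_continuous m n i j : continuous (@entry m n i j).
Proof. exact: coord_continuous. Qed.

Lemma differentiable_rV (V : normedModType R) n (f : V -> 'rV[R]_n) x :
  (forall i, differentiable (fun y => f y 0 i : R^o) x) -> differentiable f x.
Proof.
move=> df; rewrite (_ : f = \sum_(i < n) (fun y => f y 0 i *: delta_mx 0 i)).
  by apply: differentiable_sum => i; apply: differentiableZl.
by apply/funext => y; rewrite fct_sumE [LHS]row_sum_delta.
Qed.

Lemma derive_entry (V : normedModType R) m n (f : V -> 'M[R]_(m, n)) x v i j :
  derivable f x v -> 'D_v f x i j = 'D_v (fun y => f y i j : R^o) x.
Proof. by move=> df; rewrite derive_mx // mxE. Qed.

Lemma Ck_on_entry (V : normedModType R) m n k (A : set V)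
    (f : V -> 'M[R]_(m, n)) i j :
  open A -> Ck_on k A f -> Ck_on k A (fun x => f x i j : R^o).
Proof.
by move=> oA; apply: (Ck_on_linear (L := @entry m n i j)) => //;
  exact: entry_continuous.
Qed.

Lemma Ck_on_rV (V : normedModType R) n k (A : set V) (f : V -> 'rV[R]_n) :
  open A -> (forall i, Ck_on k A (fun x => f x 0 i : R^o)) -> Ck_on k A f.
Proof.
move=> oA; elim: k f => [|k IH] f /=.
  move=> cf; rewrite (_ : f = fun y => \sum_(i < n) f y 0 i *: delta_mx 0 i).
    apply: (Ck_on_sum (k := 0) (f := fun i y => f y 0 i *: delta_mx 0 i)) => //.
    by move=> i x Ax; apply: cvgZr_tmp; exact: cf.
  by apply/funext => y; rewrite [LHS]row_sum_delta.
move=> cf; have df x : A x -> differentiable f x.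
  by move=> Ax; apply: differentiable_rV => i; exact: (cf i).1.
split=> // v; apply: IH => i.
apply: (Ck_on_eq oA _ ((cf i).2 v)) => x Ax.
by rewrite derive_entry //; apply: diff_derivable; exact: df.
Qed.

Lemma dotvE n (x y : 'rV[R]_n) : dotv x y = (x *m y^T) 0 0.
Proof. by rewrite mxE; apply: eq_bigr => i _; rewrite mxE. Qed.

Lemma Ck_on_dotv (V : normedModType R) n k (A : set V) (f g : V -> 'rV[R]_n) :
  open A -> Ck_on k A f -> Ck_on k A g ->
  Ck_on k A (fun x => dotv (f x) (g x) : R^o).
Proof.
move=> oA cf cg; apply: Ck_on_sum => // i.
by apply: Ck_onM => //; exact: Ck_on_entry.
Qed.

Lemma is_derive_dotv (V : normedModType R) n (f g : V -> 'rV[R]_n) x v :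
  derivable f x v -> derivable g x v ->
  is_derive x v (fun y => dotv (f y) (g y) : R^o)
    (dotv ('D_v f x) (g x) + dotv (f x) ('D_v g x)).
Proof.
move=> df dg; rewrite /dotv -big_split /=.
rewrite (_ : (fun y => _) = \sum_(i < n) (fun y => f y 0 i * g y 0 i : R^o)).
  apply: is_derive_sum => i.
  have/derivableP dfi := (derivable_mxP _ _ _).1 df 0 i.
  have/derivableP dgi := (derivable_mxP _ _ _).1 dg 0 i.
  rewrite !derive_entry //.
  apply: (is_derive_eq (is_deriveM dfi dgi)).
  by rewrite [RHS]addrC; congr (_ + _); rewrite mulrC.
by apply/funext => y; rewrite fct_sumE.
Qed.

End smooth_functions.

(** * Mean value arguments: symmetry of second derivatives, constancy on balls *)

Section mean_value.
Context (R : realType).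

Lemma is_derive_line (V W : normedModType R) (f : V -> W) a u t :
  derivable f (t *: u + a) u ->
  is_derive t (1 : R^o) (fun r : R^o => f (r *: u + a)) ('D_u f (t *: u + a)).
Proof.
have e : (fun h : R => h^-1 *: (((fun r : R^o => f (r *: u + a)) \o shift t)
  (h *: (1 : R^o)) - f (t *: u + a))) =
    (fun h : R => h^-1 *: ((f \o shift (t *: u + a)) (h *: u)
      - f (t *: u + a))).
  by apply/funext => h /=; rewrite [h *: _]mulr1 scalerDl addrA.
by move=> df; apply: DeriveDef; rewrite /derivable /derive e.
Qed.

Lemma MVT_line (V : normedModType R) (f : V -> R^o) a u h :
  0 <= h -> (forall t, 0 <= t <= h -> derivable f (t *: u + a) u) ->
  exists2 t, 0 <= t <= h & f (h *: u + a) - f a = h * 'D_u f (t *: u + a).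
Proof.
move=> h0 df.
have dl t : 0 <= t <= h -> is_derive t (1 : R^o) (fun r : R^o => f (r *: u + a))
  ('D_u f (t *: u + a)).
  by move=> ht; apply: is_derive_line; exact: df.
have [||t] :=
  @MVT_segment R (fun r => f (r *: u + a)) (fun t => 'D_u f (t *: u + a)) 0 h
    h0.
- by move=> t; rewrite in_itv /= => /andP[t0 th]; apply: dl; rewrite !ltW.
- apply: derivable_within_continuous => t; rewrite in_itv /= => ht.
  by have [] := dl t ht.
rewrite in_itv /= scale0r add0r subr0 => ht e.
by exists t => //; rewrite e mulrC.
Qed.

Lemma line_in_ball (V : normedModType R) (x a : V) (r : R) t h u :
  `|x - a| + h * `|u| < r -> 0 <= t <= h -> ball x r (t *: u + a).
Proof.
move=> hr /andP[t0 th]; rewrite -ball_normE /ball_ /= opprD addrCA addrC.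
apply: le_lt_trans hr; apply: (le_trans (ler_normD _ _)).
rewrite lerD2l normrN normrZ ger0_norm // ler_wpM2r //.
Qed.

Lemma dist_half (p q m e : R) :
  `|p - m| < e / 2 -> `|q - m| < e / 2 -> `|p - q| <= e.
Proof.
by move=> pm qm; have := ler_distD m p q; rewrite (distrC m); lra.
Qed.

(** Schwarz's theorem. The second difference of [f] over the parallelogram spanned by [h *: u] and
    [h *: v] equals [h ^+ 2] times either mixed derivative, each at some point of a small ball
    around [x]. Continuity at [x] then brings the two mixed derivatives within every [e > 0] of each
    other. *)
Lemma derive_comm_real (V : normedModType R) (A : set V) (f : V -> R^o) x u v :
  open A -> Ck_on 2 A f -> A x -> 'D_u ('D_v f) x = 'D_v ('D_u f) x.
Proof.
move=> oA cf Ax; apply/eqP; rewrite -subr_eq0 -normr_le0;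
  apply/ler_addgt0Pl => e e0.
rewrite addr0; have e20 : 0 < e / 2 by rewrite divr_gt0.
have [df Df] := cf.
have n1 := (cvgrPdist_lt _ _).1 ((Df v).2 u x Ax) _ e20.
have n2 := (cvgrPdist_lt _ _).1 ((Df u).2 v x Ax) _ e20.
have nA : \forall y \near x, A y by exact: open_nbhs_nbhs.
have /nbhs_ballP[r /= r0 br] : \forall y \near x, A y /\ (`|'D_u ('D_v f) x
  - 'D_u ('D_v f) y| < e / 2 /\ `|'D_v ('D_u f) x - 'D_v ('D_u f) y| < e / 2).
  by apply: filterI => //; apply: filterI; [exact: n1|exact: n2].
(* This step keeps the whole parallelogram inside the ball of radius [r]; the summand 1 keeps the
   denominator positive when [u] and [v] are zero. *)
pose h := r / 2 / (1 + `|u| + `|v|).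
have d0 : 0 < 1 + `|u| + `|v| by rewrite -addrA ltr_wpDr ?addr_ge0.
have h0 : 0 < h by rewrite !divr_gt0.
have hlt : h * `|u| + h * `|v| < r.
  rewrite -mulrDr /h -mulrA; apply: (@le_lt_trans _ _ (r / 2)); last by lra.
  have q1 : (1 + `|u| + `|v|)^-1 * (`|u| + `|v|) <= 1.
    by rewrite mulrC ler_pdivrMr // mul1r -addrA lerDr.
  by rewrite -[leRHS]mulr1; apply: ler_wpM2l q1; rewrite divr_ge0 ?ltW.
have inb s t : 0 <= s <= h -> 0 <= t <= h -> ball x r (t *: v + (s *: u + x)).
  move=> hs ht; apply: (line_in_ball (h := h)) => //.
  rewrite opprD addrCA subrr addr0 normrN normrZ.
  apply: le_lt_trans hlt; rewrite lerD2r; case/andP: hs => s0 sh.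
  by rewrite ger0_norm // ler_wpM2r.
(* Two mean value steps: first along w, then along z. *)
have key w z : (forall s t, 0 <= s <= h -> 0 <= t <= h ->
  ball x r (t *: z + (s *: w + x))) ->
   exists2 y, ball x r y & f (h *: z + (h *: w + x)) - f (h *: w + x)
     - f (h *: z + x) + f x = h * (h * 'D_z ('D_w f) y) :> R.
  move=> inwz; have hh : 0 <= h <= h by rewrite lexx ltW.
  have h00 : (0:R) <= 0 <= h by rewrite lexx ltW.
  have d1 s t : 0 <= s <= h -> 0 <= t <= h ->
    differentiable f (t *: z + (s *: w + x)).
    by move=> hs ht; apply: df; have [] := br _ (inwz s t hs ht).
  have d1' s : 0 <= s <= h -> differentiable f (s *: w + x).
    by move=> hs; have := d1 s 0 hs h00; rewrite scale0r add0r.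
  have ds s : 0 <= s <= h -> differentiable (f \o shift (h *: z)) (s *: w + x).
    move=> hs; apply: differentiable_comp => //=.
    by rewrite addrC; exact: d1.
  have [|s hs] := @MVT_line _ (f \o shift (h *: z) - f) x w h (ltW h0).
    by move=> s hs; apply/diff_derivable/differentiableB;
      [exact: ds|exact: d1'].
  rewrite deriveB;
    [|by apply: diff_derivable; exact: ds|by apply: diff_derivable; exact: d1'].
  have -> : 'D_w (f \o shift (h *: z)) (s *: w + x) =
    'D_w f (h *: z + (s *: w + x)).
    rewrite /derive (_ : (fun k => _) = (fun k : R => k^-1 *:
      ((f \o shift (h *: z + (s *: w + x))) (k *: w)
        - f (h *: z + (s *: w + x))))) //.
    by apply/funext => k /=; rewrite -addrA [_ + h *: z]addrC.
  have [|t ht ->] := @MVT_line _ ('D_w f) (s *: w + x) z h (ltW h0).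
    move=> t ht; apply/diff_derivable/(Df w).1;
      by have [] := br _ (inwz s t hs ht).
  move=> e1; exists (t *: z + (s *: w + x)); first exact: inwz.
  rewrite -e1 /= !fctE /= ![_ + h *: z]addrC opprD opprK;
    exact: (esym (addrA _ _ _)).
have [y1 b1 e1] := key u v inb.
have [|y2 b2 e2] := key v u.
  move=> s t hs ht; rewrite addrCA; exact: inb.
have hI (a b : R) : h * (h * a) = h * (h * b) -> a = b.
  have h1 : h != 0 by rewrite gt_eqF.
  by move=> /(mulfI h1)/(mulfI h1).
(* The points [y1] and [y2] may differ, but both second differences are the same number up to the
   order of the terms. *)
have E : 'D_v ('D_u f) y1 = 'D_u ('D_v f) y2.
  apply: hI; rewrite -[LHS]e1 -[RHS]e2 [h *: u + (_ + _)]addrCA.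
  by congr (_ + _); exact: addrAC.
have [_ [_ m1]] := br _ b1; have [_ [m2 _]] := br _ b2.
rewrite E in m1; exact: dist_half m2 m1.
Qed.

(** Mean value theorem on the segment from [x] to [y], which stays in the ball. *)
Lemma derive0_const_ball (V : normedModType R) (f : V -> R^o) x (r : R) y :
  (forall z, ball x r z -> is_derive z (y - x) f 0) ->
  ball x r y -> f y = f x.
Proof.
move=> df bxy.
have h t : 0 <= t <= 1 -> ball x r (t *: (y - x) + x).
  apply: line_in_ball; rewrite subrr normr0 add0r mul1r distrC.
  by move: bxy; rewrite -ball_normE.
have [t ht|t ht] := @MVT_line _ f x (y - x) 1 ler01;
  first by have [] := df _ (h t ht).
have [_ ->] := df _ (h t ht); rewrite scale1r subrK mulr0 => /eqP.
by rewrite subr_eq0 => /eqP.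
Qed.

End mean_value.

(** * Orthogonal projections *)

Section orthogonal_projection.
Context (R : realType).

Lemma dotv_gt0 n (x : 'rV[R]_n) : x != 0 -> 0 < dotv x x.
Proof.
move=> x0; rewrite lt_neqAle eq_sym sumr_ge0 ?andbT; last first.
  by move=> i _; exact: sqr_ge0.
apply: contra x0 => /eqP /psumr_eq0P e; apply/eqP/rowP => i; rewrite mxE.
have /eqP := e (fun i _ => sqr_ge0 (x 0 i)) i isT.
by rewrite mulf_eq0 orbb => /eqP.
Qed.

Lemma dotv_eq0 n (x : 'rV[R]_n) : dotv x x = 0 -> x = 0.
Proof.
by move=> e; apply/eqP; apply: contraT => /dotv_gt0; rewrite e ltxx.
Qed.

Lemma dotvC n (x y : 'rV[R]_n) : dotv x y = dotv y x.
Proof. by apply: eq_bigr => i _; rewrite mulrC. Qed.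

(** The diagonal entries of [A *m A^T] are the squared lengths of the rows of [A]. *)
Lemma mulmx_tr_eq0 m n (A : 'M[R]_(m, n)) : A *m A^T = 0 -> A = 0.
Proof.
move=> e; apply/row_matrixP => i; rewrite row0; apply: dotv_eq0.
have /(congr1 (fun B : 'M[R]_m => B i i)) := e; rewrite !mxE => <-.
by apply: eq_bigr => j _; rewrite !mxE.
Qed.

(** A vector [v] in the kernel of the Gram matrix makes [v *m F] of length zero, and independence of
    the rows then gives [v = 0]. *)
Lemma gram_unit m n (F : 'M[R]_(m, n)) : row_free F -> F *m F^T \in unitmx.
Proof.
move=> fF; rewrite -row_free_unit; apply: inj_row_free => v e.
apply: (row_free_inj fF); rewrite mul0mx; apply: mulmx_tr_eq0.
by rewrite trmx_mul mulmxA -(mulmxA v) e mul0mx.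
Qed.

(** For row-free [F], the orthogonal projection onto the row space, acting on row vectors from the
    right. The inverse Gram matrix is written with determinant and adjugate, so that
    differentiability in the entries of [F] can be read off. *)
Definition projmx m n (F : 'M[R]_(m, n)) : 'M[R]_n :=
  F^T *m ((\det (F *m F^T))^-1 *: \adj (F *m F^T)) *m F.

Lemma projE m n (F : 'M[R]_(m, n)) :
  row_free F -> projmx F = F^T *m invmx (F *m F^T) *m F.
Proof. by move=> /gram_unit uG; rewrite /projmx /invmx uG. Qed.

Lemma mul_proj m n (F : 'M[R]_(m, n)) : row_free F -> F *m projmx F = F.
Proof.
by move=> fF; rewrite projE // !mulmxA mulmxV ?mul1mx // gram_unit.
Qed.

Lemma proj_sub m n p (F : 'M[R]_(m, n)) (w : 'M[R]_(p, n)) : (w *m projmx F <=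
  F)%MS.
Proof. by rewrite /projmx !mulmxA submxMl. Qed.

Lemma proj_id m n p (F : 'M[R]_(m, n)) (w : 'M[R]_(p, n)) :
  row_free F -> (w <= F)%MS -> w *m projmx F = w.
Proof. by move=> fF /submxP[a ->]; rewrite -mulmxA mul_proj. Qed.

Lemma proj_orth m n p (F : 'M[R]_(m, n)) (w : 'M[R]_(p, n)) :
  w *m F^T = 0 -> w *m projmx F = 0.
Proof. by move=> e; rewrite /projmx !mulmxA e !mul0mx. Qed.

Lemma proj_sym m n (F : 'M[R]_(m, n)) : row_free F -> (projmx F)^T = projmx F.
Proof.
by move=> fF; rewrite projE // !trmx_mul trmxK trmx_inv trmx_mul trmxK mulmxA.
Qed.

Lemma proj_mul m n (F : 'M[R]_(m, n)) :
  row_free F -> projmx F *m projmx F = projmx F.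
Proof. by move=> fF; rewrite [X in X *m _]/projmx -mulmxA mul_proj. Qed.

Lemma orth_proj m n p (F : 'M[R]_(m, n)) (w : 'M[R]_(p, n)) :
  row_free F -> w *m projmx F = 0 -> w *m F^T = 0.
Proof.
by move=> fF e; rewrite -(mul_proj fF) trmx_mul proj_sym // mulmxA e mul0mx.
Qed.

(** The rows of [F] may be dependent, so the projection is taken for a basis of its row space. *)
Lemma orth_decomp m n (F : 'M[R]_(m, n)) (z : 'rV[R]_n) :
  exists2 w, (w <= F)%MS & (z - w) *m F^T = 0.
Proof.
have fB := row_base_free F; exists (z *m projmx (row_base F)).
  by rewrite (submx_trans (proj_sub _ _)) // eq_row_base.
have /submxP[D eD] : (F <= row_base F)%MS by rewrite eq_row_base.
rewrite [X in _ *m X^T]eD trmx_mul mulmxA; set B := row_base F in fB *.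
suff -> : (z - z *m projmx B) *m B^T = 0 by rewrite mul0mx.
by apply: orth_proj => //; rewrite mulmxBl -mulmxA proj_mul // subrr.
Qed.

End orthogonal_projection.

(** * Derivatives of matrix products, determinants and projections *)

Section derive_matrix.
Context (R : realType) (V : normedModType R).

Lemma is_derive_mx m n (A : V -> 'M[R]_(m, n)) (dA : 'M[R]_(m, n)) x v :
  (forall i j, is_derive x v (fun y => A y i j : R^o) (dA i j)) ->
  is_derive x v A dA.
Proof.
move=> h; have dd : derivable A x v by apply/derivable_mxP => i j;
  have [] := h i j.
by apply: DeriveDef => //; apply/matrixP => i j; rewrite derive_entry //;
  have [] := h i j.
Qed.

Lemma is_derive_entry m n (A : V -> 'M[R]_(m, n)) dA x v i j :
  is_derive x v A dA -> is_derive x v (fun y => A y i j : R^o) (dA i j).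
Proof.
move=> [dd <-]; rewrite derive_entry //; apply: derivableP.
exact: (derivable_mxP _ _ _).1 dd i j.
Qed.

Lemma is_derive_mulmx m n p (A : V -> 'M[R]_(m, n)) (B : V -> 'M[R]_(n, p))
    dA dB x v : is_derive x v A dA -> is_derive x v B dB ->
  is_derive x v (fun y => A y *m B y) (dA *m B x + A x *m dB).
Proof.
move=> hA hB; apply: is_derive_mx => i j; rewrite !mxE -big_split /=.
rewrite (_ : (fun y => _) = \sum_(k < n) (fun y => A y i k * B y k j : R^o)).
  apply: is_derive_sum => k.
  have hi := is_derive_entry i k hA; have hj := is_derive_entry k j hB.
  apply: (is_derive_eq (is_deriveM hi hj)).
  by rewrite [RHS]addrC; congr (_ + _); rewrite mulrC.
by apply/funext => y; rewrite fct_sumE mxE.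
Qed.

Lemma is_derive_trmx m n (A : V -> 'M[R]_(m, n)) dA x v :
  is_derive x v A dA -> is_derive x v (fun y => (A y)^T) dA^T.
Proof.
move=> hA; apply: is_derive_mx => i j; rewrite mxE.
rewrite (_ : (fun y => _) = (fun y => A y j i)); first exact: is_derive_entry.
by apply/funext => y; rewrite mxE.
Qed.

(** Induction on the size, by Laplace expansion along the first row. *)
Lemma derivable_det n (A : V -> 'M[R]_n) x v :
  derivable A x v -> derivable (fun y => \det (A y) : R^o) x v.
Proof.
elim: n A => [|n IH] A dA.
  rewrite (_ : (fun y => _) = cst (1 : R^o)); first exact: derivable_cst.
  by apply/funext => y; rewrite det_mx00.
rewrite (_ : (fun y => _) =
  \sum_(j < n.+1) (fun y
    => A y ord0 j * ((-1) ^+ (0 + j) * \det (row' ord0 (col' j (A y)))) : R^o)).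
  apply: derivable_sum => j; apply: derivableM.
    exact: (derivable_mxP _ _ _).1 dA _ _.
  apply: derivableM; first exact: derivable_cst.
  apply: IH; apply/derivable_mxP => i k.
  rewrite (_ : (fun y => _) = fun y => A y (lift ord0 i) (lift j k)).
    exact: (derivable_mxP _ _ _).1 dA _ _.
  by apply/funext => y; rewrite !mxE.
by apply/funext => y; rewrite fct_sumE (expand_det_row _ ord0).
Qed.

(** Each entry of the inverse Gram matrix is a cofactor divided by the Gram determinant, which is
    nonzero at [x]. *)
Lemma derivable_proj m n (F : V -> 'M[R]_(m, n)) x v :
  derivable F x v -> row_free (F x) -> derivable (fun y => projmx (F y)) x v.
Proof.
move=> dF fF; have hF := derivableP dF.
have hG := is_derive_mulmx hF (is_derive_trmx hF).
have dI : derivable (fun y => (\det (F y *m (F y)^T))^-1 *: \adj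
  (F y *m (F y)^T)) x v.
  apply/derivable_mxP => i j.
  rewrite (_ : (fun y => _) =
    fun y => (\det (F y *m (F y)^T))^-1 *
      ((-1) ^+ (j + i) * \det (row' j (col' i (F y *m (F y)^T)))) : R^o).
    apply: derivableM.
      apply: derivableV; last by apply: derivable_det; have [] := hG.
      by have := gram_unit fF; rewrite unitmxE unitfE.
    apply: derivableM; first exact: derivable_cst.
    apply: derivable_det; apply/derivable_mxP => k l.
    rewrite (_ : (fun y => _) =
      fun y => (F y *m (F y)^T) (lift j k) (lift i l)).
      by apply: (derivable_mxP _ _ _).1; have [] := hG.
    by apply/funext => y; rewrite 2!mxE.
  by apply/funext => y; rewrite 2!mxE.
by have [] :=
  is_derive_mulmx (is_derive_mulmx (is_derive_trmx hF) (derivableP dI)) hF.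
Qed.

(* With F' = Z F and P = projmx F, differentiating F P = F gives F P' = 0, hence
   P P' = 0 and, by symmetry, P' P = 0, so that P' = (P P)' = 0. *)
Lemma derive_proj0 m n (F : V -> 'M[R]_(m, n)) x v :
  (\forall y \near x, row_free (F y)) -> derivable F x v ->
  ('D_v F x <= F x)%MS -> is_derive x v (fun y => projmx (F y)) 0.
Proof.
move=> nF dF sF; have fF := nbhs_singleton nF.
have dP := derivable_proj dF fF; have hF := derivableP dF;
  have hP := derivableP dP.
apply: DeriveDef => //; set P' := 'D_v _ x in hP *; set F' := 'D_v F x in hF sF.
have e1 : F' *m projmx (F x) + F x *m P' = F'.
  have h := is_derive_mulmx hF hP;
    rewrite -[RHS]derive_val -[LHS](@derive_val _ _ _ _ _ _ _ h).
  apply: near_eq_derive; near=> y; apply: mul_proj; near: y; exact: nF.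
have e2 : F x *m P' = 0.
  by move/eqP: e1; rewrite proj_id // addrC -subr_eq0 addrK => /eqP.
have e3 : projmx (F x) *m P' = 0 by rewrite /projmx -mulmxA e2 mulmx0.
have e4 : P'^T = P'.
  have h := is_derive_trmx hP; rewrite -[LHS](@derive_val _ _ _ _ _ _ _ h).
  apply: near_eq_derive; near=> y; apply: proj_sym; near: y; exact: nF.
have e5 : P' *m projmx (F x) = 0.
  by rewrite -[LHS]trmxK trmx_mul proj_sym // e4 e3 trmx0.
have e6 : P' *m projmx (F x) + projmx (F x) *m P' = P'.
  have h := is_derive_mulmx hP hP; rewrite -[LHS](@derive_val _ _ _ _ _ _ _ h).
  apply: near_eq_derive; near=> y; apply: proj_mul; near: y; exact: nF.
by rewrite -e6 e5 e3 addr0.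
Unshelve. all: by end_near. Qed.

End derive_matrix.

(** * Constancy on connected manifolds *)

Section constancy.

(** Each level set is open, and so is its complement. *)
Lemma locally_constant_connected (T : topologicalType) (X : Type) (h : T -> X) :
  connected [set: T] -> (forall p, \forall q \near p, h q = h p) ->
  forall p q, h p = h q.
Proof.
move=> cT lc p q.
suff : [set r | h r = h p] = setT by move/seteqP => [_ /(_ q I)] /=.
apply: cT; first by exists p.
  exists [set r | h r = h p]; last by rewrite setTI.
  rewrite openE => r /= e; have := lc r; apply: filterS => r' /= ->; exact: e.
exists [set r | h r = h p]; last by rewrite setTI.
rewrite -[X in closed X]setCK; apply: open_closedC.
rewrite openE => r /= e; have := lc r; apply: filterS => r' /= ->; exact: e.
Qed.

(** A ball in a chart is star-shaped about its centre, so the mean value theorem makes every entry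
    locally constant; connectedness does the rest. *)
Lemma derive0_constant (R : realType) (V : normedModType R) (M : manifold V)
    m n (h : M -> 'M[R]_(m, n)) :
  connected [set: M] ->
  (forall (c : chart M) p, dom c p ->
    forall u, is_derive (coord c p) u (h \o param c) 0) ->
  forall p q, h p = h q.
Proof.
move=> cM dh; apply: locally_constant_connected => // p.
have [c cp] := dom_cover p.
have : nbhs (coord c p) (coord c @` dom c).
  by apply: open_nbhs_nbhs; split; [exact: codom_open|exists p].
move=> /nbhs_ballP[r /= r0 br].
have n1 : \forall q \near p, dom c q by apply: open_nbhs_nbhs; split=> //;
  exact: dom_open.
have n2 : \forall q \near p, ball (coord c p) r (coord c q).
  by apply: (coord_cont cp); exact: nbhsx_ballx.
near=> q; have cq : dom c q by near: q.
have bq : ball (coord c p) r (coord c q) by near: q.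
apply/matrixP => i j.
rewrite -(coordK cq) -[in RHS](coordK cp).
apply: (@derive0_const_ball R V (fun z => h (param c z) i j) _ r)
  => // z /br[q' cq' <-].
have := is_derive_entry i j (dh c q' cq' (coord c q - coord c p)).
by rewrite mxE.
Unshelve. all: by end_near. Qed.

End constancy.

(** * Calculus in charts *)

Section charts.
Context (R : realType) (V : normedModType R) (M : manifold V).
Implicit Types (c : chart M) (p : M).

Lemma nbhs_codom c p : dom c p -> nbhs (coord c p) (coord c @` dom c).
Proof.
by move=> cp; apply: open_nbhs_nbhs; split; [exact: codom_open|exists p].
Qed.

Lemma nbhs_overlap c (O : set M) p : open O -> O p -> dom c p ->
  nbhs (coord c p) (coord c @` (dom c `&` O)).
Proof.
by move=> oO Op cp; apply: open_nbhs_nbhs; split;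
  [exact: overlap_open|exists p].
Qed.

Lemma smoothE (W : normedModType R) (f : M -> W) c :
  smooth f -> Coo_on (coord c @` dom c) (f \o param c).
Proof. by move=> /(_ c); rewrite setIT. Qed.

Lemma smooth_on_differentiable (W : normedModType R) O (f : M -> W) c p :
  smooth_on O f -> O p -> dom c p -> differentiable (f \o param c) (coord c p).
Proof. by move=> /(_ c 1)[df _] Op cp; apply: df; exists p. Qed.

Lemma smooth_differentiable (W : normedModType R) (f : M -> W) c p :
  smooth f -> dom c p -> differentiable (f \o param c) (coord c p).
Proof. by move=> sf; apply: smooth_on_differentiable sf _. Qed.

(** Chain rule through the transition map: near the point, [f \o param c'] is [f \o param c] after
    [coord c \o param c']. *)
Lemma dchart_change (W : normedModType R) (f : M -> W) c c' p u :
  dom c p -> dom c' p -> differentiable (f \o param c) (coord c p) ->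
  dchart c' u f p = dchart c (dchart c' u (coord c) p) f p.
Proof.
move=> cp c'p df; rewrite /dchart.
have dt : differentiable (coord c \o param c') (coord c' p).
  by have [dt _] := transition_smooth c' c 1; apply: dt; exists p.
have e : (coord c \o param c') (coord c' p) = coord c p by rewrite /= coordK.
rewrite (@near_eq_derive _ _ _ _ ((f \o param c) \o (coord c \o param c'))).
  by rewrite !deriveE ?diff_comp ?e //; apply: differentiable_comp; rewrite ?e.
have := nbhs_overlap (dom_open c) cp c'p.
apply: filterS => _ [q [c'q cq] <-].
by rewrite /= (coordK c'q) (coordK cq).
Qed.

End charts.

(** * Splitting into tangent and normal parts *)

Section normal_part.
Context (R : realType) (V : normedModType R) (M : manifold V) (N : nat).
Variables (f : M -> 'rV[R]_N) (p : M) (m : nat) (F : 'M[R]_(m, N)).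
Hypothesis tanE : forall w, tangent_space f p w <-> (w <= F)%MS.

Lemma normal_spaceE w : normal_space f p w <-> w *m F^T = 0.
Proof.
split=> [h|e t /tanE/submxP[a ->]]; last first.
  by rewrite dotvE -mulmxA -[F]trmxK -trmx_mul e trmx0 mulmx0 mxE.
apply/rowP => i; rewrite [RHS]mxE.
have /h : tangent_space f p (row i F) by apply/tanE; exact: row_sub.
move=> <-; rewrite mxE /dotv; apply: eq_bigr => j _.
by rewrite !mxE mulrC.
Qed.

Lemma normal_part_spec z :
  normal_space f p (normal_part f p z) /\
  tangent_space f p (z - normal_part f p z).
Proof.
have [w sw nw] := orth_decomp F z.
(* The choice made by [xget] meets its specification once a witness exists; the remainder of [z]
   after projection to the row space of [F] is one. *)
apply: (@xgetPex _ 0 [set w | normal_space f p w /\ tangent_space f p (z - w)]).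
exists (z - w); split; first exact/normal_spaceE.
by apply/tanE; rewrite opprB addrC subrK.
Qed.

(** The difference of two candidates is both tangent and normal, hence orthogonal to itself. *)
Lemma normal_part_unique z w :
  normal_space f p w -> tangent_space f p (z - w) -> normal_part f p z = w.
Proof.
move=> nw tw; have [nz tz] := normal_part_spec z.
apply/eqP; rewrite -subr_eq0; apply/eqP/dotv_eq0.
have h : tangent_space f p (normal_part f p z - w).
  rewrite tanE; have -> : normal_part f p z - w =
    (z - w) - (z - normal_part f p z).
    by rewrite opprB [RHS]addrC addrA subrK.
  by apply: addmx_sub; [exact/tanE|rewrite eqmx_opp; exact/tanE].
suff : normal_space f p (normal_part f p z - w) by apply.
by apply/normal_spaceE; rewrite mulmxBl !(normal_spaceE _).1 // subrr.
Qed.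

End normal_part.

(** * Jacobians in charts and parallel normal fields *)

Section euclidean_charts.
Context (R : realType) (n N : nat) (M : manifold 'rV[R]_n).
Implicit Types (c : chart M) (p : M) (f xi : M -> 'rV[R]_N).

(** Vectors are rows, so for smooth [f] the differential is right multiplication by this matrix and
    the tangent space is its row space. *)
Definition jac c f p : 'M[R]_(n, N) := jacobian (f \o param c) (coord c p).

Lemma dchartE f c p u : smooth f -> dom c p -> dchart c u f p = u *m jac c f p.
Proof.
by move=> sf cp; rewrite /dchart deriveEjacobian //;
  exact: smooth_differentiable.
Qed.

Lemma tangent_spaceE f c p : smooth f -> dom c p ->
  forall w, tangent_space f p w <-> (w <= jac c f p)%MS.
Proof.
move=> sf cp w; split=> [[c' [u [c'p ->]]]|/submxP[u ->]].
  rewrite (dchart_change _ cp c'p) ?dchartE ?submxMl //.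
  exact: smooth_differentiable.
by exists c, u; rewrite dchartE.
Qed.

Lemma jac_row_free f c p : immersion f -> dom c p -> row_free (jac c f p).
Proof.
move=> [sf inj] cp; apply: inj_row_free => v e.
by apply: (inj c p cp); rewrite !dchartE // mul0mx.
Qed.

(* A normal field is parallel for the normal connection when its derivative in
   R^N is tangent; this avoids the choice made in [normal_part]. *)
Definition parallel_normal f xi := smooth xi /\
  forall c p, dom c p -> xi p *m (jac c f p)^T = 0 /\
    forall u, (dchart c u xi p <= jac c f p)%MS.

Lemma smooth_lin f xi a : smooth f -> smooth xi ->
  smooth (fun p => a *: f p + xi p).
Proof.
move=> sf sx c k; have oA := overlap_open c (@openT M).
apply: Ck_onD => //; last exact: sx.
apply: Ck_on_rV => // i.
rewrite (_ : (fun x => _) = fun x => (cst a x : R^o) * ((f \o param c) x 0 i :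
  R^o)).
  apply: Ck_onM => //; first exact: Ck_on_cst.
  by apply: Ck_on_entry => //; exact: sf.
by apply/funext => x; rewrite /= mxE.
Qed.

Lemma dchart_lin f xi a c p u : smooth f -> smooth xi -> dom c p ->
  dchart c u (fun q => a *: f q + xi q) p =
    a *: dchart c u f p + dchart c u xi p.
Proof.
move=> sf sx cp; have df := smooth_differentiable sf cp.
have dx := smooth_differentiable sx cp.
have d1 := derivableP (diff_derivable (v:=u) df).
have d2 := derivableP (diff_derivable (v:=u) dx).
by have [_ e] := is_deriveD (is_deriveZ a d1) d2; exact: e.
Qed.

Lemma parallel_normal_lin f xi eta a :
  parallel_normal f xi -> parallel_normal f eta ->
  parallel_normal f (fun p => a *: xi p + eta p).
Proof.
move=> [sx hx] [se he]; split; first exact: smooth_lin.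
move=> c p cp; have [n1 t1] := hx c p cp; have [n2 t2] := he c p cp.
split=> [|u]; first by rewrite mulmxDl -scalemxAl n1 n2 scaler0 addr0.
by rewrite dchart_lin // addmx_sub // scalemx_sub.
Qed.

Lemma parallel_normal0 f : parallel_normal f (fun=> 0).
Proof.
split=> [c k|c p cp]; first exact: Ck_on_cst.
split=> [|u]; first by rewrite mul0mx.
by rewrite /dchart (_ : _ \o _ = cst 0) // derive_cst sub0mx.
Qed.

Lemma parallel_normalZ f xi a :
  parallel_normal f xi -> parallel_normal f (fun p => a *: xi p).
Proof.
move=> px; have := parallel_normal_lin a px (parallel_normal0 f).
by rewrite (_ : (fun p => _ + 0) = fun p => a *: xi p) //; apply/funext => p;
  rewrite addr0.
Qed.

(** Used to remove from a field its components along a frame. *)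
Lemma parallel_normalB_sum f xi s (a : 'I_s -> R) (e : 'I_s -> M -> 'rV[R]_N) :
  parallel_normal f xi -> (forall i, parallel_normal f (e i)) ->
  parallel_normal f (fun p => xi p - \sum_(i < s) a i *: e i p).
Proof.
move=> px pe; elim: (index_enum _) => [|i l IH].
  by rewrite (_ : (fun p => _) = xi) //; apply/funext => p;
    rewrite big_nil subr0.
rewrite (_ : (fun p => _) =
  fun p => (- a i) *: e i p + (xi p - \sum_(i <- l) a i *: e i p)).
  exact: parallel_normal_lin.
by apply/funext => p; rewrite big_cons scaleNr opprD addrCA.
Qed.

(** In the product rule each term pairs a tangent vector with a normal one, so the inner product has
    zero derivative. *)
Lemma parallel_normal_const f xi eta :
  connected [set: M] -> parallel_normal f xi -> parallel_normal f eta ->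
  forall p q, dotv (xi p) (eta p) = dotv (xi q) (eta q).
Proof.
move=> cM [sx hx] [se he] p q; rewrite !dotvE; congr (fun_of_matrix _ _ _).
apply: (@derive0_constant _ _ M _ _ (fun r => xi r *m (eta r)^T))
  => // c r cr u.
have [n1 t1] := hx c r cr; have [n2 t2] := he c r cr.
have d1 := derivableP (diff_derivable (v:=u) (smooth_differentiable sx cr)).
have d2 := derivableP (diff_derivable (v:=u) (smooth_differentiable se cr)).
apply: (is_derive_eq (is_derive_mulmx d1 (is_derive_trmx d2))).
have /submxP[a e1] := t1 u; have /submxP[b e2] := t2 u.
rewrite -/(dchart c u xi r) -/(dchart c u eta r) e1 e2 /= coordK //.
by rewrite trmx_mul mulmxA n1 mul0mx addr0 -mulmxA -[jac _ _ _]trmxK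
  -trmx_mul n2 trmx0 mulmx0.
Qed.

End euclidean_charts.

(** * Parallel normal frames *)

Section parallel_frame.
Context (R : realType) (n N : nat) (M : manifold 'rV[R]_n).
Variable f : M -> 'rV[R]_N.
Hypothesis (f_imm : immersion f) (M_conn : connected [set: M]).

Definition frame_mx s (e : 'I_s -> M -> 'rV[R]_N) (p : M) : 'M[R]_(s, N) :=
  \matrix_(i < s) e i p.

Lemma mul_frame_mx s (e : 'I_s -> M -> 'rV[R]_N) p (y : 'rV[R]_s) :
  y *m frame_mx e p = \sum_(i < s) y 0 i *: e i p.
Proof. by rewrite mulmx_sum_row; apply: eq_bigr => i _; rewrite rowK. Qed.

Lemma orthonormal_mx s (e : 'I_s -> 'rV[R]_N) :
  (forall i j, dotv (e i) (e j) = (i == j)%:R) <->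
  (\matrix_i e i) *m (\matrix_i e i)^T = 1%:M.
Proof.
have E i j : dotv (e i) (e j) = ((\matrix_i e i) *m (\matrix_i e i)^T) i j.
  by rewrite mxE; apply: eq_bigr => k _; rewrite !mxE.
split=> [h|h i j]; last by rewrite E h mxE.
by apply/matrixP => i j; rewrite -E h mxE.
Qed.

(** The identity of size [s] factors through a space of dimension [N]; compare ranks. *)
Lemma orthonormal_bound s (A : 'M[R]_(s, N)) : A *m A^T = 1%:M -> (s <= N)%N.
Proof.
move=> e; rewrite -(mxrank1 R s) -e.
by rewrite (leq_trans (mxrankM_maxl _ _)) // rank_leq_col.
Qed.

(** Orthonormal families have at most [N] members, so one of maximal size exists. Removing from [xi]
    its components along it leaves a parallel normal field orthogonal to the family; were it
    nonzero, normalizing it would enlarge the family. *)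
Lemma parallel_normal_frame : [set: M] !=set0 ->
  exists s (e : 'I_s -> M -> 'rV[R]_N),
  [/\ forall i, parallel_normal f (e i),
      forall p, frame_mx e p *m (frame_mx e p)^T = 1%:M &
      forall xi, parallel_normal f xi -> forall q,
        exists2 y : 'rV[R]_s, y = xi q *m (frame_mx e q)^T &
          forall p, xi p = y *m frame_mx e p].
Proof.
case=> o _.
(* Orthonormality is asked at the base point [o] only; constancy of inner products carries it to
   every point. *)
pose P s := exists2 e : 'I_s -> M ->
  'rV[R]_N, forall i, parallel_normal f (e i) &
  frame_mx e o *m (frame_mx e o)^T = 1%:M.
have exP : exists s, `[< P s >].
  exists 0%N; apply/asboolP; exists (fun _ _ => 0); first by case.
  by apply/matrixP => -[].
have bP s : `[< P s >] -> (s <= N)%N.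
  by move=> /asboolP[e _]; exact: orthonormal_bound.
have [s /asboolP[e pe oe] smax] := ex_maxnP exP bP.
have oeP p : frame_mx e p *m (frame_mx e p)^T = 1%:M.
  apply/orthonormal_mx => i j.
  by rewrite (parallel_normal_const M_conn (pe i) (pe j) p o);
    exact: (orthonormal_mx (e ^~ o)).2.
exists s, e; split=> // xi px q; exists (xi q *m (frame_mx e q)^T) => // p.
pose a i := dotv (xi o) (e i o).
pose eta r := xi r - \sum_(i < s) a i *: e i r.
have peta : parallel_normal f eta by exact: parallel_normalB_sum.
have aE r i : dotv (xi r) (e i r) =
  a i by exact: (parallel_normal_const M_conn px (pe i) r o).
have etaE r : eta r = xi r - xi r *m (frame_mx e r)^T *m frame_mx e r.
  rewrite mul_frame_mx; congr (_ - _); apply: eq_bigr => i _; congr (_ *: _).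
  by rewrite -(aE r) mxE; apply: eq_bigr => j _; rewrite !mxE.
have eta_orth r : eta r *m (frame_mx e r)^T = 0.
  by rewrite etaE mulmxBl -(mulmxA _ (frame_mx e r)) oeP mulmx1 subrr.
(* The length of [eta] is constant, so vanishing at [o] means vanishing everywhere. *)
suff eta0 : eta o = 0.
  have eta0' r : eta r = 0.
    apply: dotv_eq0; rewrite (parallel_normal_const M_conn peta peta r o).
    by rewrite eta0 dotvE mul0mx mxE.
  move/eqP: (eta0' p); rewrite subr_eq0 => /eqP ->.
  rewrite mul_frame_mx; apply: eq_bigr => i _; congr (_ *: _).
  by rewrite -(aE q) mxE; apply: eq_bigr => j _; rewrite !mxE.
apply: contrapT => /eqP/dotv_gt0 n0.
pose k := (Num.sqrt (dotv (eta o) (eta o)))^-1.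
have k2 : k * k * dotv (eta o) (eta o) = 1.
  by rewrite -expr2 exprVn sqr_sqrtr ?ltW // mulVf // gt_eqF.
(* The family [e] with the normalized remainder in the last position, which contradicts the
   maximality of [s]. *)
pose e' (i : 'I_s.+1) := if unlift ord_max i is Some j then e j else (fun r
  => k *: eta r).
have : (s.+1 <= s)%N; last by rewrite ltnn.
apply: smax; apply/asboolP; exists e'.
  by move=> i; rewrite /e'; case: (unliftP ord_max i) => [j _|_] //;
    exact: parallel_normalZ.
have dee i j := (orthonormal_mx (e ^~ o)).2 oe i j.
have deta i : dotv (eta o) (e i o) = 0.
  have := eta_orth o => /(congr1 (fun B : 'rV[R]_s => B 0 i));
    rewrite !mxE => <-.
  by apply: eq_bigr => j _; rewrite !mxE.
apply/orthonormal_mx => i j; rewrite /e'.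
case: (unliftP ord_max i) => [i' ->|->];
  case: (unliftP ord_max j) => [j' ->|->].
- by rewrite dee (inj_eq lift_inj).
- rewrite dotvC dotvE -scalemxAl mxE -dotvE deta mulr0 eq_sym.
  by rewrite (negbTE (neq_lift _ _)).
- by rewrite dotvE -scalemxAl mxE -dotvE deta mulr0 (negbTE (neq_lift _ _)).
by rewrite eqxx dotvE linearZ /= -scalemxAl -scalemxAr scalerA mxE -dotvE k2.
Qed.

Section frame.
Variables (s : nat) (e : 'I_s -> M -> 'rV[R]_N).
Hypotheses (e_par : forall i, parallel_normal f (e i))
  (e_orth : forall p, frame_mx e p *m (frame_mx e p)^T = 1%:M).

Definition frame_span (p : M) : {vspace 'rV[R]_N} :=
  <<[tuple e i p | i < s]>>%VS.

Lemma frame_spanP p w :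
  w \in frame_span p <-> exists y : 'rV[R]_s, y *m frame_mx e p = w.
Proof.
split=> [h|[y <-]]; last first.
  rewrite mul_frame_mx memv_suml // => i _; apply/memvZ/memv_span/tnthP.
  by exists i; rewrite tnth_mktuple.
exists (\row_i vector.coord [tuple e i p | i < s] i w).
rewrite mul_frame_mx [RHS](coord_span h); apply: eq_bigr => i _.
by rewrite mxE nth_mktuple.
Qed.

Lemma is_derive_frame c p u : dom c p ->
  exists2 D : 'M[R]_(s, N), (D <= jac c f p)%MS &
    is_derive (coord c p) u (frame_mx e \o param c) D.
Proof.
move=> cp; exists (\matrix_i dchart c u (e i) p).
  by apply/row_subP => i; rewrite rowK; have [_ h] := e_par i;
    have [_] := h c p cp; apply.
apply: is_derive_mx => i j; rewrite mxE.
rewrite (_ : (fun y => _) = fun y => (e i \o param c) y 0 j); last first.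
  by apply/funext => y; rewrite /= mxE.
apply: is_derive_entry; apply/derivableP/diff_derivable.
by apply: smooth_differentiable => //; have [] := e_par i.
Qed.

Lemma frame_normal p y : normal_space f p (y *m frame_mx e p).
Proof.
have [c cp] := dom_cover p.
apply/(normal_spaceE (tangent_spaceE f_imm.1 cp)).
rewrite mul_frame_mx mulmx_suml big1 // => i _.
by have [_ h] := e_par i; have [h0 _] := h c p cp;
  rewrite -scalemxAl h0 scaler0.
Qed.

(** The product rule splits the derivative into ['D_u k] times the frame, which is normal, and [k]
    times the derivative of the frame, which is tangent. Thus the normal connection acts as plain
    differentiation of the coefficients. *)
Lemma nabla_perp_frame c p u (eta : M -> 'rV[R]_N) (k : 'rV[R]_n -> 'rV[R]_s) :
  dom c p -> derivable k (coord c p) u ->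
  (\forall z \near coord c p, eta (param c z) = k z *m frame_mx e (param c z))
    ->
  nabla_perp f c u eta p = 'D_u k (coord c p) *m frame_mx e p.
Proof.
move=> cp dk ek; have [D sD hD] := is_derive_frame u cp.
apply: (normal_part_unique (tangent_spaceE f_imm.1 cp));
  first exact: frame_normal.
apply/(tangent_spaceE f_imm.1 cp).
have hm := is_derive_mulmx (derivableP dk) hD.
rewrite /dchart (near_eq_derive u ek) (@derive_val _ _ _ _ _ _ _ hm) /=
  coordK //.
by rewrite addrC addKr mulmx_sub.
Qed.

End frame.

End parallel_frame.

Lemma derive_comm (R : realType) (V : normedModType R) n (A : set V)
    (f : V -> 'rV[R]_n) x u v :
  open A -> Coo_on A f -> A x -> 'D_u ('D_v f) x = 'D_v ('D_u f) x.
Proof.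
move=> oA cf Ax.
have E w w' i : 'D_w ('D_w' f) x 0 i = 'D_w ('D_w' (fun y => f y 0 i : R^o)) x.
  have [df Df] := cf 2.
  rewrite derive_entry; last by apply: diff_derivable; exact: (Df w').1.
  apply: near_eq_derive; have : \forall y \near x, A y by exact: open_nbhs_nbhs.
  by apply: filterS => y Ay; rewrite derive_entry //; apply: diff_derivable;
    exact: df.
apply/rowP => i; apply: (eq_trans (E u v i)).
have cfi : Ck_on 2 A (fun y => f y 0 i : R^o) by exact: Ck_on_entry oA (cf 2).
exact: eq_trans (derive_comm_real u v oA cfi Ax) (esym (E v u i)).
Qed.

(** * The flat bundle spanned by a parallel orthonormal frame *)

Section frame_bundle.
Context (R : realType) (n N : nat) (M : manifold 'rV[R]_n).
Variable f : M -> 'rV[R]_N.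
Hypothesis f_imm : immersion f.
Variables (s : nat) (e : 'I_s -> M -> 'rV[R]_N).
Hypotheses (e_par : forall i, parallel_normal f (e i))
  (e_orth : forall p, frame_mx e p *m (frame_mx e p)^T = 1%:M).

(** The frame is a global basis: multiplying a linear relation by the transposed frame returns its
    coefficients. *)
Lemma subbundle_frame_span : subbundle (frame_span e).
Proof.
move=> p; exists setT, s, e; split=> //; first exact: openT.
  by move=> i; have [] := e_par i.
move=> q _; rewrite basisEfree subvv size_tuple /= andbC.
suff fr : free [tuple e i q | i < s].
  by rewrite fr /= (eqP (fr : \dim _ == size _)) size_tuple leqnn.
apply/freeP => k h i.
have : (\row_i k i) *m frame_mx e q = 0.
  rewrite mul_frame_mx -[RHS]h; apply: eq_bigr => j _.
  by rewrite mxE nth_mktuple.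
move=> /(congr1 (fun B => B *m (frame_mx e q)^T)).
by rewrite mul0mx -mulmxA e_orth mulmx1 => /rowP/(_ i); rewrite !mxE.
Qed.

(** The coefficients are the inner products with the frame, which are smooth. *)
Lemma section_coefficients O xi c : section_on (frame_span e) O xi ->
  exists k : 'rV[R]_n -> 'rV[R]_s, Coo_on (coord c @` (dom c `&` O)) k /\
    forall z, (coord c @` (dom c `&` O)) z ->
      xi (param c z) = k z *m frame_mx e (param c z).
Proof.
move=> [oO sx mx];
  exists (fun z => xi (param c z) *m (frame_mx e (param c z))^T).
have oA := overlap_open c oO.
split=> [k|_ [q [cq Oq] <-]].
  apply: Ck_on_rV => // i.
  rewrite (_ : (fun x => _) =
    fun x => dotv ((xi \o param c) x) ((e i \o param c) x)).
    apply: Ck_on_dotv => //; first exact: sx.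
    have [se _] := e_par i; apply: Ck_on_sub (smoothE c se k).
    by move=> _ [r [? ?] <-]; exists r.
  by apply/funext => x; rewrite mxE; apply: eq_bigr => j _; rewrite !mxE.
rewrite coordK //; have /frame_spanP[y <-] := mx q Oq.
by rewrite -(mulmxA y) e_orth mulmx1.
Qed.

Lemma nabla_perp_section O xi c k p u : open O ->
  Coo_on (coord c @` (dom c `&` O)) k ->
  (forall z, (coord c @` (dom c `&` O)) z ->
      xi (param c z) = k z *m frame_mx e (param c z)) ->
  dom c p -> O p ->
  nabla_perp f c u xi p = 'D_u k (coord c p) *m frame_mx e p.
Proof.
move=> oO ck ek cp Op; apply: nabla_perp_frame => //.
  by apply: diff_derivable; apply: (ck 1).1; exists p.
by apply: filterS (nbhs_overlap oO Op cp).
Qed.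

(** On frame coefficients the connection is ordinary differentiation, so flatness is the symmetry of
    second derivatives. *)
Lemma flat_parallel_frame_span : flat_parallel_subbundle f (frame_span e).
Proof.
split.
- exact: subbundle_frame_span.
- by move=> p w /frame_spanP[y <-]; exact: frame_normal.
- move=> O xi sec c p Op cp u; have [k [ck ek]] := section_coefficients c sec.
  have [oO _ _] := sec; apply/frame_spanP; exists ('D_u k (coord c p)).
  by rewrite (nabla_perp_section u oO ck ek).
- move=> O xi sec c p Op cp u v; have [k [ck ek]] := section_coefficients c sec.
  have [oO _ _] := sec; have oA := overlap_open c oO.
  have D w w' : nabla_perp f c w (nabla_perp f c w' xi) p =
      'D_w ('D_w' k) (coord c p) *m frame_mx e p.
    (* The inner covariant derivative again has smooth coefficients, namely ['D_w' k], so the same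
       formula applies a second time. *)
    apply: (nabla_perp_section _ oO) => //; first by move=> j;
      exact: (ck j.+1).2.
    move=> _ [q [cq Oq] <-]; rewrite coordK //.
    exact: (nabla_perp_section w' oO ck ek).
  by rewrite !D (derive_comm _ _ oA ck) //; exists p.
Qed.

Lemma parallel_bundle_isometry_frame :
  parallel_bundle_isometry f (frame_span e) (fun p y => y *m frame_mx e p).
Proof.
split.
- by move=> p a x y; rewrite mulmxDl scalemxAl.
- move=> p y y'; rewrite !dotvE trmx_mul mulmxA -(mulmxA y) e_orth mulmx1 //.
- by move=> p w; exact: frame_spanP.
- move=> c k; have oA : open ((coord c @` dom c) `*` [set: 'rV[R]_s]).
    by apply: openX; [exact: codom_open|exact: openT].
  (* Joint smoothness in the base point and the fibre variable comes from this product map; its two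
     projections give the factors of each summand. *)
  have cp i : Ck_on k ((coord c @` dom c) `*` [set: 'rV[R]_s])
      (fun x : 'rV[R]_n * 'rV[R]_s => (e i (param c x.1), x.2)).
    apply: (Ck_on_prod (f0 := e i \o param c) (f1 := id));
      [exact: codom_open|exact: openT| |].
      by have [se _] := e_par i; exact: smoothE.
    exact: Ck_on_id.
  apply: Ck_on_rV => // j.
  rewrite (_ : (fun x => _) = fun x : 'rV[R]_n * 'rV[R]_s
    => \sum_(i < s) x.2 0 i * e i (param c x.1) 0 j).
    apply: (Ck_on_sum (W := R^o)) => // i; apply: Ck_onM => //.
      apply: Ck_on_entry => //.
      apply: (Ck_on_linear (L := @snd 'rV[R]_N 'rV[R]_s) _ oA (cp i)).
      by move=> y; exact: cvg_snd.
    apply: (Ck_on_entry (f := fun x => e i (param c x.1))) => //.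
    apply: (Ck_on_linear (L := @fst 'rV[R]_N 'rV[R]_s) _ oA (cp i)).
    by move=> y; exact: cvg_fst.
  by apply/funext => x; rewrite mxE; apply: eq_bigr => i _; rewrite !mxE.
- move=> y c p cp u; rewrite (nabla_perp_frame f_imm e_par (k := cst y)) //.
  + by rewrite derive_cst mul0mx.
  by apply: filterE => z.
Qed.

Lemma parallel_normal_frame_comb y :
  parallel_normal f (fun p => y *m frame_mx e p).
Proof.
rewrite (_ : (fun p => _) = fun p => 0 - \sum_(i < s) (- y 0 i) *: e i p).
  exact: parallel_normalB_sum (parallel_normal0 f) e_par.
apply/funext => p; rewrite mul_frame_mx sub0r -sumrN.
by apply: eq_bigr => i _; rewrite scaleNr opprK.
Qed.

(** Weingarten formula; there is no normal term because [xi] is parallel. *)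
Lemma dchart_shape_op xi c p u : parallel_normal f xi -> dom c p ->
  shape_op f c p (xi p) u *m jac c f p = - dchart c u xi p.
Proof.
move=> [sx hx] cp; have [nx tx] := hx c p cp; have [sf _] := f_imm.
have /submxP[w0 ew] := tx u.
(* Obtained by differentiating the orthogonality of ['D_v f] and [xi] along [u]; only the normal
   part of the second derivative pairs with [xi]. *)
have gauss v : dotv (second_ff f c p u v) (xi p) =
    - dotv (dchart c v f p) (dchart c u xi p).
  have -> : dotv (second_ff f c p u v) (xi p) =
    dotv (dchart c u (dchart c v f) p) (xi p).
    have [_ ts] :=
      normal_part_spec (tangent_spaceE sf cp) (dchart c u (dchart c v f) p).
    have /(_ _ ts) := (normal_spaceE (tangent_spaceE sf cp) (xi p)).2 nx.
    rewrite !dotvE mulmxBl mxE [X in _ + X]mxE => /eqP.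
    by rewrite subr_eq0 => /eqP <-.
  apply/eqP; rewrite -subr_eq0 opprK; apply/eqP.
  have [df Df] := smoothE c sf 2;
    have cx : (coord c @` dom c) (coord c p) by exists p.
  have e1 : dchart c u (dchart c v f) p =
    'D_u ('D_v (f \o param c)) (coord c p).
    apply: near_eq_derive; apply: filterS (nbhs_codom cp) => _ [q cq <-].
    by rewrite /= /dchart coordK.
  have d1 : derivable ('D_v (f \o param c)) (coord c p) u.
    by apply: diff_derivable; exact: (Df v).1.
  have d2 : derivable (xi \o param c) (coord c p) u.
    by apply: diff_derivable; exact: smooth_differentiable.
  have [_ <-] : is_derive (coord c p) u (fun z => dotv ('D_v (f \o param c) z)
    ((xi \o param c) z) : R^o) 0.
    apply: (near_eq_is_derive (f := cst (0 : R^o))).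
    apply: filterS (nbhs_codom cp) => _ [q cq <-].
    have [nq _] := hx c q cq.
    have e2 : 'D_v (f \o param c) (coord c q) = v *m jac c f q :=
      dchartE v sf cq.
    have e3 : (xi \o param c) (coord c q) = xi q by rewrite /= coordK.
    by rewrite e2 e3 dotvC dotvE trmx_mul mulmxA nq mul0mx mxE.
  have [_ ->] := is_derive_dotv d1 d2.
  have e4 : (xi \o param c) (coord c p) = xi p by rewrite /= coordK.
  by rewrite e1 e4.
(* The vector [- w0] satisfies the defining property of the shape operator, so [xget] does not
   return its default value. *)
have spec : forall v, dotv (dchart c (shape_op f c p (xi p) u) f p)
  (dchart c v f p) =
    dotv (second_ff f c p u v) (xi p).
  apply: (@xgetPex _ 0 [set w | forall v, dotv (dchart c w f p) (dchart c v f p)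
    =
                            dotv (second_ff f c p u v) (xi p)]).
  exists (- w0) => v; rewrite gauss ew dchartE // mulNmx -ew dotvE mulNmx mxE
    -dotvE.
  by rewrite dotvC.
apply/eqP; rewrite -subr_eq0 opprK ew -mulmxDl; apply/eqP/dotv_eq0.
(* Testing [spec] on [d] itself shows that the image of [d] under the differential has length
   zero. *)
set d := _ + w0.
have := spec d; rewrite gauss ew !(dchartE _ sf cp) => h.
have dD (x y z : 'rV[R]_N) : dotv (x + y) z = dotv x z + dotv y z.
  by rewrite !dotvE mulmxDl mxE.
by rewrite [X in dotv X _]mulmxDl dD h (dotvC (w0 *m _)) addNr.
Qed.

(** By the Weingarten formula, the differential of [h] is that of [f] composed with [I - A]. Both
    differentials are injective, hence so is [I - A], an endomorphism of a finite-dimensional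
    space. *)
Lemma shape_op_bijective xi h c p : parallel_normal f xi -> immersion h ->
  (forall q, h q = f q + xi q) -> dom c p ->
  bijective (fun u : 'rV[R]_n => u - shape_op f c p (xi p) u).
Proof.
move=> px ih eh cp; have [sf _] := f_imm; have [sx _] := px.
have hE : h = fun q => 1 *: f q + xi q by apply/funext => q; rewrite scale1r eh.
have B u : (u - shape_op f c p (xi p) u) *m jac c f p = u *m jac c h p.
  apply: eq_trans (dchartE u ih.1 cp); rewrite hE dchart_lin // scale1r.
  by rewrite mulmxBl (dchart_shape_op u px cp) opprK; congr (_ + _);
    rewrite dchartE.
(* The shape operator is given by a choice, so its linearity has to be derived: a matrix [K]
   relating the two Jacobians is found first, then identified with [I - A] by injectivity of the
   differential of [f]. *)
have /submxP[K eK] : (jac c h p <= jac c f p)%MS.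
  by apply/row_subP => i; rewrite rowE -B submxMl.
have BK u : u - shape_op f c p (xi p) u = u *m K.
  by apply: (row_free_inj (jac_row_free f_imm cp)); rewrite B eK mulmxA.
have uK : K \in unitmx.
  rewrite -row_free_unit; apply: inj_row_free => v vK.
  by apply: (row_free_inj (jac_row_free ih cp)); rewrite eK mulmxA vK !mul0mx.
exists (mulmx^~ (invmx K)) => u; rewrite BK; [exact: mulmxK|exact: mulmxKV].
Qed.

Lemma Omega_frame (h : M -> 'rV[R]_N) y : immersion h ->
  (forall q, h q = f q + y *m frame_mx e q) ->
  Omega f (fun p y => y *m frame_mx e p) y.
Proof.
move=> ih eh c p cp.
exact: shape_op_bijective (parallel_normal_frame_comb y) ih eh cp.
Qed.

End frame_bundle.

(** * Immersions of products with a polar metric *)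

Section slices.
Context (R : realType) (V0 V1 W : normedModType R).
Implicit Types (phi : V0 * V1 -> W) (x : V0) (y : V1).

(** The difference quotients themselves coincide, so derivability and the value of the derivative
    both transfer. *)
Let slice1_quotient phi x y v :
  (fun h : R => h^-1 *: (((fun z => phi (x, z)) \o shift y) (h *: v)
    - phi (x, y))) =
  (fun h : R => h^-1 *: ((phi \o shift (x, y)) (h *: ((0, v) : V0 * V1))
    - phi (x, y))).
Proof.
apply/funext => h; congr (_ *: (phi _ - _)).
by congr pair; rewrite /= scaler0 add0r.
Qed.

Let slice0_quotient phi x y u :
  (fun h : R => h^-1 *: (((fun z => phi (z, y)) \o shift x) (h *: u)
    - phi (x, y))) =
  (fun h : R => h^-1 *: ((phi \o shift (x, y)) (h *: ((u, 0) : V0 * V1))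
    - phi (x, y))).
Proof.
apply/funext => h; congr (_ *: (phi _ - _)).
by congr pair; rewrite /= scaler0 add0r.
Qed.

Lemma derive_slice1 phi x y v : 'D_v (fun z => phi (x, z)) y =
  'D_(0, v) phi (x, y).
Proof. by rewrite /derive slice1_quotient. Qed.

Lemma derive_slice0 phi x y u : 'D_u (fun z => phi (z, y)) x =
  'D_(u, 0) phi (x, y).
Proof. by rewrite /derive slice0_quotient. Qed.

Lemma derivable_slice0 phi x y u :
  derivable phi (x, y) (u, 0) -> derivable (fun z => phi (z, y)) x u.
Proof. by rewrite /derivable slice0_quotient. Qed.

Lemma differentiable_slice1 phi x y :
  differentiable phi (x, y) -> differentiable (fun z => phi (x, z)) y.
Proof.
move=> dphi; apply: (@differentiable_comp _ _ _ _ (fun z : V1 => (x, z)) phi)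
  => //.
Qed.

Lemma differentiable_slice0 phi x y :
  differentiable phi (x, y) -> differentiable (fun z => phi (z, y)) x.
Proof.
move=> dphi; apply: (@differentiable_comp _ _ _ _ (fun z : V0 => (z, y)) phi)
  => //.
Qed.

Lemma Ck_on_slice1 k (A0 : set V0) (A1 : set V1) phi x :
  A0 x -> Ck_on k (A0 `*` A1) phi -> Ck_on k A1 (fun y => phi (x, y)).
Proof.
move=> Ax; elim: k phi => [|k IH] phi /=.
  move=> cphi y Ay; apply: (@continuous_comp _ _ _ (fun z : V1 => (x, z)) phi).
    by apply: cvg_pair; [exact: cvg_cst|exact: cvg_id].
  by apply: cphi; split.
case=> dphi Dphi; split=> [y Ay|v]; first by apply/differentiable_slice1/dphi.
rewrite (_ : 'D_v _ = fun y => 'D_(0, v) phi (x, y));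
  first exact: (IH _ (Dphi _)).
by apply/funext => y; exact: derive_slice1.
Qed.

Lemma Ck_on_slice0 k (A0 : set V0) (A1 : set V1) phi y :
  A1 y -> Ck_on k (A0 `*` A1) phi -> Ck_on k A0 (fun x => phi (x, y)).
Proof.
move=> Ay; elim: k phi => [|k IH] phi /=.
  move=> cphi x Ax; apply: (@continuous_comp _ _ _ (fun z : V0 => (z, y)) phi).
    by apply: cvg_pair; [exact: cvg_id|exact: cvg_cst].
  by apply: cphi; split.
case=> dphi Dphi; split=> [x Ax|u]; first by apply/differentiable_slice0/dphi.
rewrite (_ : 'D_u _ = fun x => 'D_(u, 0) phi (x, y));
  first exact: (IH _ (Dphi _)).
by apply/funext => x; exact: derive_slice0.
Qed.

End slices.

(** * Mixed second derivatives in a product chart *)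

Section mixed_derivative.
Context (R : realType) (V0 V1 : normedModType R) (N : nat).
Variables (phi : V0 * V1 -> 'rV[R]_N) (A0 : set V0) (A1 : set V1).
Hypotheses (oA0 : open A0) (oA1 : open A1) (phi_smooth :
  Coo_on (A0 `*` A1) phi).
Hypothesis orth : forall z, (A0 `*` A1) z -> forall u v,
  dotv ('D_(u, 0) phi z) ('D_(0, v) phi z) = 0.
Hypothesis polar0 : forall x y y', A0 x -> A1 y -> A1 y' -> forall u u',
  dotv ('D_(u, 0) phi (x, y)) ('D_(u', 0) phi (x, y)) =
  dotv ('D_(u, 0) phi (x, y')) ('D_(u', 0) phi (x, y')).

(* As in Koszul's formula, the expression is both symmetric and antisymmetric
   in u and u'. *)
Lemma mixed_derivative_orth x y u u' v : A0 x -> A1 y ->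
  dotv ('D_(u, 0) ('D_(0, v) phi) (x, y)) ('D_(u', 0) phi (x, y)) = 0.
Proof.
move=> Ax Ay; have oA : open (A0 `*` A1) by exact: openX.
have Axy : (A0 `*` A1) (x, y) by split.
have dD w w' : derivable ('D_w phi) (x, y) w'.
  by apply: diff_derivable; apply: ((phi_smooth 2).2 w).1.
have comm w w' : 'D_w ('D_w' phi) (x, y) = 'D_w' ('D_w phi) (x, y).
  exact: derive_comm oA phi_smooth Axy.
have nA : \forall z \near (x, y), (A0 `*` A1) z by exact: open_nbhs_nbhs.
pose B a b := dotv ('D_(a, 0) ('D_(0, v) phi) (x, y)) ('D_(b, 0) phi (x, y)).
(* Differentiates the orthogonality of the two factors along [a]; by commutation of derivatives the
   right-hand side is symmetric in [a] and [b]. *)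
have skew a b : B a b =
  - dotv ('D_(a, 0) ('D_(b, 0) phi) (x, y)) ('D_(0, v) phi (x, y)).
  have [_ e] := is_derive_dotv (dD (b, 0) (a, 0)) (dD (0, v) (a, 0)).
  have e0 : 'D_(a, 0) (fun z => dotv ('D_(b, 0) phi z) ('D_(0, v) phi z) : R^o)
    (x, y) = 0.
    rewrite (@near_eq_derive _ _ _ _ (cst (0 : R^o))) ?derive_cst //.
    by apply: filterS nA => z Az; exact: orth.
  have /esym/eqP := eq_trans (esym e0) e.
  by rewrite addrC addr_eq0 dotvC => /eqP.
have sym : B u u' = B u' u by rewrite !skew comm.
(* Inner products of directions of the first factor do not vary along the second, so their
   derivative along [v] is zero. *)
have anti : B u u' + B u' u = 0.
  have [_ e] := is_derive_dotv (dD (u, 0) (0, v)) (dD (u', 0) (0, v)).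
  have e0 : 'D_(0, v) (fun z => dotv ('D_(u, 0) phi z) ('D_(u', 0) phi z) : R^o)
    (x, y) = 0.
    rewrite -(@derive_slice1 _ _ _ _ (fun z => dotv ('D_(u, 0) phi z)
      ('D_(u', 0) phi z) : R^o)).
    rewrite (@near_eq_derive _ _ _ _
      (cst (dotv ('D_(u, 0) phi (x, y)) ('D_(u', 0) phi (x, y)) : R^o)))
        ?derive_cst //.
    have : \forall z \near y, A1 z by exact: open_nbhs_nbhs.
    by apply: filterS => z Az; exact: polar0.
  have := eq_trans (esym e0) e.
  by rewrite comm [X in _ + dotv _ X]comm [X in _ + X]dotvC => ->.
rewrite -/(B u u'); move: anti; rewrite -sym => /eqP.
by rewrite -mulr2n mulrn_eq0 /= => /eqP.
Qed.

End mixed_derivative.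

(** * Slices of the immersion and tangency of the mixed derivative *)

Section product.
Context (R : realType) (n0 n1 N : nat).
Context (M0 : manifold 'rV[R]_n0) (M1 : manifold 'rV[R]_n1).
Variables (g : metric (prod_manifold M0 M1)) (f : prod_manifold M0 M1 ->
  'rV[R]_N).
Hypotheses (g_polar : polar g) (f_imm : immersion f) (f_iso : isometric g f)
  (f_adapted : adapted f).

Let phi (c0 : chart M0) (c1 : chart M1) (z : 'rV[R]_n0 * 'rV[R]_n1) :
  'rV[R]_N :=
  f (param c0 z.1, param c1 z.2).

Definition slice0 (p1 : M1) (p0 : M0) : 'rV[R]_N := f (p0, p1).
Definition slice1 (p0 : M0) (p1 : M1) : 'rV[R]_N := f (p0, p1).

Lemma prod_chart_smooth c0 c1 :
  Coo_on ((coord c0 @` dom c0) `*` (coord c1 @` dom c1)) (phi c0 c1).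
Proof.
move=> k; have := @smoothE _ _ (prod_manifold M0 M1) _ f (c0, c1) f_imm.1 k.
rewrite (_ : _ @` _ = (coord c0 @` dom c0) `*` (coord c1 @` dom c1)) //.
exact: (pcoord_image (M0 := M0) (M1 := M1) (c0, c1) (dom c0) (dom c1)).
Qed.

Lemma slice0_smooth p1 : smooth (slice0 p1).
Proof.
have [c1 cp1] := dom_cover p1; move=> c0 k; rewrite setIT.
have := Ck_on_slice0 (ex_intro2 _ _ p1 cp1 erefl) (@prod_chart_smooth c0 c1 k).
by rewrite /phi /= coordK.
Qed.

Lemma slice1_smooth p0 : smooth (slice1 p0).
Proof.
have [c0 cp0] := dom_cover p0; move=> c1 k; rewrite setIT.
have := Ck_on_slice1 (ex_intro2 _ _ p0 cp0 erefl) (@prod_chart_smooth c0 c1 k).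
by rewrite /phi /= coordK.
Qed.

Lemma dchart_slice0 c0 c1 p0 p1 u : dom c1 p1 ->
  dchart c0 u (slice0 p1) p0 = 'D_(u, 0) (phi c0 c1) (coord c0 p0, coord c1 p1).
Proof.
move=> cp1; rewrite -derive_slice0 /dchart /phi /= coordK //.
Qed.

Lemma dchart_slice1 c0 c1 p0 p1 v : dom c0 p0 ->
  dchart c1 v (slice1 p0) p1 = 'D_(0, v) (phi c0 c1) (coord c0 p0, coord c1 p1).
Proof.
move=> cp0; rewrite -derive_slice1 /dchart /phi /= coordK //.
Qed.

Lemma dchart_prod c0 c1 p0 p1 u v : dom c0 p0 -> dom c1 p1 ->
  @dchart _ _ (prod_manifold M0 M1) _ (c0, c1) (u, v) f (p0, p1) =
  dchart c0 u (slice0 p1) p0 + dchart c1 v (slice1 p0) p1.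
Proof.
move=> cp0 cp1; rewrite (@dchart_slice0 _ c1) // (@dchart_slice1 c0) //.
have df : differentiable (phi c0 c1) (coord c0 p0, coord c1 p1).
  by apply: (@prod_chart_smooth c0 c1 1).1; split; [exists p0|exists p1].
rewrite !deriveE // -linearD (_ : (u, 0) + (0, v) = (u, v));
  first exact: deriveE.
by congr pair; rewrite ?addr0 ?add0r.
Qed.

Lemma slice0_immersion p1 : immersion (slice0 p1).
Proof.
split=> [|c0 p0 cp0 u u' e]; first exact: slice0_smooth.
have [c1 cp1] := dom_cover p1.
have := @f_imm.2 (c0, c1) (p0, p1) (conj cp0 cp1) (u, 0) (u', 0).
by rewrite !dchart_prod // e => /(_ erefl) [].
Qed.

Lemma slice1_immersion p0 : immersion (slice1 p0).
Proof.
split=> [|c1 p1 cp1 v v' e]; first exact: slice1_smooth.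
have [c0 cp0] := dom_cover p0.
have := @f_imm.2 (c0, c1) (p0, p1) (conj cp0 cp1) (0, v) (0, v').
by rewrite !dchart_prod // e => /(_ erefl) [].
Qed.

(** The isometry condition is evaluated on vectors [(u, 0)] and [(0, v)], for which the polar metric
    loses the terms containing a zero component. *)
Lemma polar_isometric : exists g0 : metric M0,
  [/\ forall c0 c1 p0 p1, dom c0 p0 -> dom c1 p1 -> forall u v,
        dotv (dchart c0 u (slice0 p1) p0) (dchart c1 v (slice1 p0) p1) = 0 &
      forall c0 p0 p1, dom c0 p0 -> forall u u',
        dotv (dchart c0 u (slice0 p1) p0) (dchart c0 u' (slice0 p1) p0) =
          g0 c0 p0 u u'].
Proof.
have [g0 [g1 [rg0 [rg1 _] gE]]] := g_polar.
have lin0 (V : normedModType R) (M : manifold V) (h : metric M) c p v :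
  riemannian h -> dom c p -> h c p 0 v = 0 /\ h c p v 0 = 0.
  move=> rh cp; have h0 : h c p 0 v = 0.
    have := metric_linear rh cp 1 0 0 v.
    by rewrite scaler0 addr0 mul1r => /esym/eqP;
      rewrite -subr_eq0 addrK => /eqP.
  by split=> //; rewrite (metric_sym rh cp).
have key c0 c1 p0 p1 u v u' v' (cp0 : dom c0 p0) (cp1 : dom c1 p1) :
    dotv (dchart c0 u (slice0 p1) p0 + dchart c1 v (slice1 p0) p1)
         (dchart c0 u' (slice0 p1) p0 + dchart c1 v' (slice1 p0) p1) =
    g0 c0 p0 u u' + g1 p0 c1 p1 v v'.
  have cp : @dom _ _ (prod_manifold M0 M1) (c0, c1) (p0, p1) by [].
  have := f_iso cp (u, v) (u', v').
  by rewrite (dchart_prod u v cp0 cp1) (dchart_prod u' v' cp0 cp1) gE.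
have d0 c p0 p1 : dchart c 0 (slice0 p1) p0 = 0 by exact: derive0.
have d1 c p0 p1 : dchart c 0 (slice1 p0) p1 = 0 by exact: derive0.
have e0 c0 c1 p0 p1 u : dchart c0 u (slice0 p1) p0 + dchart c1 0 (slice1 p0) p1
  = dchart c0 u (slice0 p1) p0.
  by rewrite d1 addr0.
have e1 c0 c1 p0 p1 v : dchart c0 0 (slice0 p1) p0 + dchart c1 v (slice1 p0) p1
  = dchart c1 v (slice1 p0) p1.
  by rewrite d0 add0r.
exists g0; split=> [c0 c1 p0 p1 cp0 cp1 u v|c0 p0 p1 cp0 u u'].
  rewrite -(e0 c0 c1 p0 p1 u) -(e1 c0 c1 p0 p1 v);
    apply: (eq_trans (key _ _ _ _ _ _ _ _ cp0 cp1)).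
  by rewrite (lin0 _ _ _ _ _ u rg0 cp0).2 (lin0 _ _ _ _ _ v (rg1 p0) cp1).1
    addr0.
have [c1 cp1] := dom_cover p1.
rewrite -(e0 c0 c1 p0 p1 u) -(e0 c0 c1 p0 p1 u').
apply: (eq_trans (key _ _ _ _ _ _ _ _ cp0 cp1)).
by rewrite (lin0 _ _ _ _ _ 0 (rg1 p0) cp1).1 addr0.
Qed.

(** In a product chart the differential of [f] is multiplication by the stacked Jacobians of the two
    slices. *)
Lemma tangent_space_prod c0 c1 p0 p1 : dom c0 p0 -> dom c1 p1 -> forall w,
  tangent_space f (p0, p1) w <->
  (w <= col_mx (jac c0 (slice0 p1) p0) (jac c1 (slice1 p0) p1))%MS.
Proof.
move=> cp0 cp1 w.
have dE u v : @dchart _ _ (prod_manifold M0 M1) _ (c0, c1) (u, v) f (p0, p1) =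
    row_mx u v *m col_mx (jac c0 (slice0 p1) p0) (jac c1 (slice1 p0) p1).
  rewrite dchart_prod // mul_row_col !dchartE //;
    [exact: slice1_smooth|exact: slice0_smooth].
have cp : @dom _ _ (prod_manifold M0 M1) (c0, c1) (p0, p1) by [].
split=> [[c' [u [c'p ->]]]|/submxP[a ->]]; last first.
  by exists (c0, c1), (lsubmx a, rsubmx a); rewrite dE hsubmxK.
rewrite (dchart_change _ cp c'p);
  last exact: (smooth_differentiable f_imm.1 cp).
by case: (dchart c' u _ _) => a b; rewrite dE submxMl.
Qed.

(** Adaptedness removes the normal part. The component along the first factor is orthogonal to the
    whole vector by [mixed_derivative_orth] and to the other component by polarity, hence to
    itself. *)
Lemma mixed_derivative_tangent c0 c1 p0 p1 u v : dom c0 p0 -> dom c1 p1 ->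
  ('D_(u, 0) ('D_(0, v) (phi c0 c1)) (coord c0 p0, coord c1 p1) <=
   jac c1 (slice1 p0) p1)%MS.
Proof.
move=> cp0 cp1; have [g0 [orth g0E]] := polar_isometric.
set z := 'D_(u, 0) _ _.
have cp : @dom _ _ (prod_manifold M0 M1) (c0, c1) (p0, p1) by [].
have tz : tangent_space f (p0, p1) z.
  have [_] := normal_part_spec (tangent_space_prod cp0 cp1) z.
  suff -> : normal_part f (p0, p1) z = 0 by rewrite subr0.
  have <- := f_adapted cp (erefl : net0 (u, 0)) (erefl : net1 (0, v)).
  (* Matches the coordinate derivative with the iterated [dchart] that defines [second_ff]; the
     inner functions agree only near the point. *)
  have ez : z = @dchart _ _ (prod_manifold M0 M1) _ (c0, c1) (u, 0)
      (@dchart _ _ (prod_manifold M0 M1) _ (c0, c1) (0, v) f) (p0, p1).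
    have nb := nbhs_codom cp.
    apply: (@near_eq_derive R ('rV[R]_n0 * 'rV[R]_n1)%type _
      ('D_(0,v) (phi c0 c1)) _ (coord c0 p0, coord c1 p1) (u,0)).
    apply: filterS nb => _ [q cq <-].
    have /(congr1 (@dchart _ _ (prod_manifold M0 M1) _ (c0, c1) (0, v) f)) :=
      coordK cq.
    by move=> /esym.
  by rewrite ez.
have /submxP[a] := (tangent_space_prod cp0 cp1 z).1 tz.
rewrite -(hsubmxK a) mul_row_col; set a0 := lsubmx a; set a1 := rsubmx a => ez.
suff a00 : a0 *m jac c0 (slice0 p1) p0 = 0 by rewrite ez a00 add0r submxMl.
have zorth : dotv z (a0 *m jac c0 (slice0 p1) p0) = 0.
  rewrite -(dchartE _ (slice0_smooth p1) cp0).
  rewrite (dchart_slice0 _ _ _ cp1).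
  apply: (@mixed_derivative_orth _ _ _ _ (phi c0 c1) _ _ (codom_open c0)
    (codom_open c1) (@prod_chart_smooth c0 c1)); last 2 first.
  - by exists p0.
  - by exists p1.
  - move=> [_ _] [/= [q0 c0q0 <-] [q1 c1q1 <-]] u1 v1.
    by rewrite -(dchart_slice0 _ _ _ c1q1) -(dchart_slice1 _ _ _ c0q0);
      exact: orth.
  move=> _ _ _ [q0 c0q0 <-] [q1 c1q1 <-] [q1' c1q1' <-] u1 v1.
  by rewrite -!(dchart_slice0 _ _ _ c1q1) -!(dchart_slice0 _ _ _ c1q1') !g0E.
have aorth : dotv (a1 *m jac c1 (slice1 p0) p1) (a0 *m jac c0 (slice0 p1) p0) =
  0.
  rewrite dotvC -(dchartE _ (slice0_smooth p1) cp0)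
    -(dchartE _ (slice1_smooth p0) cp1).
  exact: orth.
apply: dotv_eq0; move: zorth; rewrite ez !dotvE mulmxDl mxE -!dotvE aorth addr0.
by [].
Qed.

End product.

(** * Leaves along the second factor: tangent projection and parallel differences *)

Section leaves.
Context (R : realType) (n0 n1 N : nat).
Context (M0 : manifold 'rV[R]_n0) (M1 : manifold 'rV[R]_n1).
Variables (g : metric (prod_manifold M0 M1)) (f : prod_manifold M0 M1 ->
  'rV[R]_N).
Hypotheses (g_polar : polar g) (f_imm : immersion f) (f_iso : isometric g f)
  (f_adapted : adapted f).
Let phi (c0 : chart M0) (c1 : chart M1) (z : 'rV[R]_n0 * 'rV[R]_n1) :
  'rV[R]_N :=
  f (param c0 z.1, param c1 z.2).

Hypothesis (M0_conn : connected [set: M0]).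

(** Row [i] of the Jacobian of a leaf is the derivative of [f] along the [i]-th coordinate of [M1],
    so moving the leaf produces mixed derivatives. *)
Lemma is_derive_jac_slice1 (c0 : chart M0) (c1 : chart M1) (p0 : M0) (p1 : M1) u
  : dom c0 p0 -> dom c1 p1 ->
  is_derive (coord c0 p0) u ((fun q => jac c1 (slice1 f q) p1) \o param c0)
    (\matrix_i 'D_(u, 0) ('D_(0, delta_mx 0 i) (phi c0 c1)) (coord c0 p0,
      coord c1 p1)).
Proof.
move=> cp0 cp1; apply: is_derive_mx => i j; rewrite mxE.
pose h := 'D_(0, delta_mx 0 i) (phi c0 c1).
apply: (@near_eq_is_derive _ _ _ (fun x => (h (x, coord c1 p1)) 0 j : R^o)).
  apply: filterS (nbhs_codom cp0) => _ [q cq <-].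
  rewrite /h -(dchart_slice1 _ c1 _ _ cq) (dchartE _ (slice1_smooth f_imm q)
    cp1).
  by rewrite -rowE mxE /= coordK.
apply: is_derive_entry; rewrite -/h -derive_slice0;
  apply/derivableP/derivable_slice0.
apply: diff_derivable; apply: ((prod_chart_smooth f_imm c0 c1 2).2 _).1.
by split; [exists p0|exists p1].
Qed.

(** As the leaf varies, the derivative of its Jacobian stays in the row space, which is the
    situation of [derive_proj0]. *)
Lemma proj_leaf_const (c1 : chart M1) (p1 : M1) (p0 q0 : M0) : dom c1 p1 ->
  projmx (jac c1 (slice1 f p0) p1) = projmx (jac c1 (slice1 f q0) p1).
Proof.
move=> cp1.
apply: (@derive0_constant _ _ M0 _ _ (fun q => projmx (jac c1 (slice1 f q) p1))
  M0_conn).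
move=> c0 q cq u; have hD := is_derive_jac_slice1 u cq cp1.
apply: (@derive_proj0 _ _ _ _ ((fun q => jac c1 (slice1 f q) p1) \o param c0)).
- by apply: filterE => x; exact: (jac_row_free (slice1_immersion f_imm _) cp1).
- by have [] := hD.
rewrite derive_val /= coordK //; apply/row_subP => i; rewrite rowK.
exact: (mixed_derivative_tangent g_polar f_imm f_iso f_adapted).
Qed.

(** The projection for the leaf through [o] is also the one for the leaf through [q], and it kills
    derivatives of [f] along [M0] at [q] because the factors are orthogonal. *)
Lemma slice1_proj_const (c1 : chart M1) (p1 : M1) (o p0 q0 : M0) : dom c1 p1 ->
  slice1 f p0 p1 *m projmx (jac c1 (slice1 f o) p1) =
  slice1 f q0 p1 *m projmx (jac c1 (slice1 f o) p1).
Proof.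
move=> cp1; have [g0 [orth _]] := polar_isometric g_polar f_imm f_iso.
set T := projmx _.
apply: (@derive0_constant _ _ M0 _ _ (fun q => slice0 f p1 q *m T) M0_conn).
move=> c0 q cq u.
have d1 := derivableP
  (diff_derivable (v:=u) (smooth_differentiable (slice0_smooth f_imm p1) cq)).
apply: (is_derive_eq (is_derive_mulmx d1 (is_derive_cst T _ _))).
rewrite mulmx0 addr0 /T (proj_leaf_const o q cp1); apply: proj_orth.
apply/rowP => i; rewrite [RHS]mxE -(orth c0 c1 q p1 cq cp1 u (delta_mx 0 i)).
rewrite (dchartE _ (slice1_smooth f_imm q) cp1) -rowE mxE.
by apply: eq_bigr => k _; rewrite !mxE.
Qed.

(** The two leaves have the same tangential component, so their difference is normal; they have the
    same tangent space over [p1], so its derivative is tangent. The factor [-1] fits the shape of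
    [smooth_lin] and [dchart_lin]. *)
Lemma parallel_normal_leaf (o p0 : M0) :
  parallel_normal (slice1 f o) (fun p1 => -1 *: slice1 f o p1 + slice1 f p0 p1).
Proof.
split=> [|c1 p1 cp1].
  by apply: smooth_lin; exact: slice1_smooth.
have fo := jac_row_free (slice1_immersion f_imm o) cp1.
have fp := jac_row_free (slice1_immersion f_imm p0) cp1.
split=> [|u].
  apply: orth_proj => //.
  by rewrite scaleN1r mulmxDl mulNmx (slice1_proj_const o o p0 cp1) addNr.
rewrite dchart_lin //; [|exact: slice1_smooth|exact: slice1_smooth].
rewrite (dchartE _ (slice1_smooth f_imm o) cp1)
  (dchartE _ (slice1_smooth f_imm p0) cp1).
apply: addmx_sub; first by rewrite scalemx_sub // submxMl.
rewrite -(mul_proj fp) (proj_leaf_const p0 o cp1) mulmxA.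
exact: proj_sub.
Qed.

End leaves.

(** * Construction of the partial tube *)

Theorem theorem16 (R : realType) (n0 n1 N : nat)
    (M0 : manifold 'rV[R]_n0) (M1 : manifold 'rV[R]_n1)
    (M_nonempty : [set: prod_manifold M0 M1] !=set0)
    (M_connected : connected [set: prod_manifold M0 M1])
    (g : metric (prod_manifold M0 M1))
    (g_riemannian : riemannian g) (g_polar : polar g)
    (f : prod_manifold M0 M1 -> 'rV[R]_N)
    (f_immersion : immersion f) (f_isometric : isometric g f)
    (f_adapted : adapted f) :
  exists (f1 : M1 -> 'rV[R]_N) (s : nat) (E : M1 -> {vspace 'rV[R]_N})
         (phi : M1 -> 'rV[R]_s -> 'rV[R]_N) (f0 : M0 -> 'rV[R]_s),
    [/\ immersion f1,
        flat_parallel_subbundle f1 E,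
        parallel_bundle_isometry f1 E phi,
        immersion f0 /\ (forall p0, Omega f1 phi (f0 p0)) &
        forall (p0 : M0) (p1 : M1),
          f (p0, p1) = partial_tube f0 f1 phi (p0, p1)].
Proof.
have [[q0 q1] _] := M_nonempty.
(* Each factor is the image of the connected product under a projection, surjective since the other
   factor has a point. *)
have M0_conn : connected [set: M0].
  have -> : [set: M0] = fst @` [set: prod_manifold M0 M1].
    by apply/seteqP; split=> // p _; exists (p, q1).
  apply: connected_continuous_connected => //.
  by apply: continuous_subspaceT => p; exact: cvg_fst.
have M1_conn : connected [set: M1].
  have -> : [set: M1] = snd @` [set: prod_manifold M0 M1].
    by apply/seteqP; split=> // p _; exists (q0, p).
  apply: connected_continuous_connected => //.
  by apply: continuous_subspaceT => p; exact: cvg_snd.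
(* The leaf through [q0] is the base of the tube, so [f0] vanishes at [q0]. *)
pose f1 := slice1 f q0; have f1_imm : immersion f1 by exact: slice1_immersion.
have M1_ne : [set: M1] !=set0 by exists q1.
have [s [e [e_par e_orth e_span]]] := parallel_normal_frame f1 M1_conn M1_ne.
pose xi p0 p1 := -1 *: f1 p1 + slice1 f p0 p1.
have xi_par p0 : parallel_normal f1 (xi p0).
  exact: (parallel_normal_leaf g_polar).
(* The frame coefficients of [xi p0] are read off at [q1]; by [e_span] they reproduce [xi p0] at
   every point. *)
pose f0 p0 : 'rV[R]_s := xi p0 q1 *m (frame_mx e q1)^T.
have fE p0 p1 : slice1 f p0 p1 = f1 p1 + f0 p0 *m frame_mx e p1.
  have [_ -> xiE] := e_span _ (xi_par p0) q1.
  by rewrite /f0 -xiE /xi scaleN1r addNKr.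
exists f1, s, (frame_span e), (fun p y => y *m frame_mx e p), f0; split.
- by [].
- exact: flat_parallel_frame_span.
- exact: parallel_bundle_isometry_frame.
- split; last first.
    move=> p0; apply: (Omega_frame f1_imm e_par (h := slice1 f p0)) => //.
    exact: slice1_immersion.
  have f0_smooth : smooth f0.
    move=> c k; have oA := overlap_open c (@openT M0).
    apply: Ck_on_rV => // i.
    rewrite (_ : (fun x => _) =
      fun x => dotv ((slice0 f q1 \o param c) x + cst (- f1 q1) x)
        (cst (e i q1) x)).
      apply: Ck_on_dotv => //; last exact: Ck_on_cst.
      apply: Ck_onD => //; last exact: Ck_on_cst.
      exact: (slice0_smooth f_immersion).
    apply/funext => x; rewrite mxE; apply: eq_bigr => j _.
    by rewrite !mxE /= mulN1r addrC.
  split=> [|c p0 cp0 u v euv]; first exact: f0_smooth.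
  have [_ inj] := slice0_immersion f_immersion q1; apply: (inj c p0 cp0).
  (* Over [q1] the slice of [f] is a constant plus [f0] times a fixed matrix, so equal derivatives
     of [f0] give equal derivatives of an immersion. *)
  have dE w : dchart c w (slice0 f q1) p0 = dchart c w f0 p0 *m frame_mx e q1.
    have d1 := derivableP
      (diff_derivable (v:=w) (smooth_differentiable f0_smooth cp0)).
    have hm := is_derive_mulmx d1 (is_derive_cst (frame_mx e q1) (coord c p0)
      w).
    have [_ e1] := is_deriveD (is_derive_cst (f1 q1) (coord c p0) w) hm.
    rewrite /dchart (_ : slice0 f q1 \o param c = cst (f1 q1) +
      (fun x => (f0 \o param c) x *m cst (frame_mx e q1) x)).
      by rewrite e1 mulmx0 addr0 add0r.
    by apply/funext => x; exact: fE.
  by rewrite !dE euv.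
- by move=> p0 p1; exact: fE.
Qed.
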